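(* Let $G$ be hyperbolic relative to $H_1,\dots,H_n$, let $X(G)$ be the associated Bowditch space, and let $m=\max_{i=1,\ldots,n}\ell\text{-}\mathrm{asdim}(H_i)$. Then $$\max\{\mathrm{asdim}(G),\,m\}\le \mathrm{asdim}(X(G))\le\max\{\mathrm{asdim}(G),\,m+1\}.$$
   Context: Finitely generated groups are regarded as metric spaces via word metrics for finite generating sets. A family $\mathcal U$ of subsets of a metric space $X$ is $D$-bounded if every $U\in\mathcal U$ has diameter at most $D$; its $r$-multiplicity is the infimal integer $k$ such that every subset of $X$ of diameter at most $r$ meets at most $k$ members of $\mathcal U$. $\mathrm{asdim}(X)$ (asymptotic dimension) is the smallest $n\in\mathbb N\cup\{\infty\}$ such that for all $r>0$ there exist $D(r)<\infty$ and a $D(r)$-bounded cover of $X$ with $r$-multiplicity at most $n+1$. $\ell\text{-}\mathrm{asdim}(X)$ (linearly controlled asymptotic dimension) is the smallest $n$ such that there exists $L<\infty$ with the property that for all sufficiently large $r<\infty$ there exists an $Lr$-bounded cover of $X$ with $r$-multiplicity at most $n+1$ (and $\infty$ if there is no such $n$). Horoballs. For a connected graph $\Gamma$ with vertex set $V$, edge set $E$ and all edges of length one, the horoball $\mathcal H(\Gamma)$ is the metric graph with vertex set $V\times\mathbb N$ (with $0\in\mathbb N$), edges $((v,n),(v,n+1))$ of length $1$ for all $v\in V$, $n\in\mathbb N$, and edges $((v,n),(v',n))$ of length $e^{-n}$ for all $(v,v')\in E$, $n\in\mathbb N$. Relative hyperbolicity. Let $G$ be a finitely generated group, $\{H_i\}_{i=1}^n$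 finitely generated subgroups, and $S$ a finite generating set of $G$ such that $S\cap H_i$ generates $H_i$ for each $i$. Let $\Gamma(G,S)$ be the Cayley graph. The Bowditch space $X(G)=X(G,\{H_i\},S)$ is the space obtained by gluing to $\Gamma(G,S)$, for each $i$ and each left coset $gH_i$, a copy of $\mathcal H(\Gamma(H_i,S\cap H_i))$ along $g\Gamma(H_i,S\cap H_i)$ (identified with level $0$ of the horoball), with the path metric. $G$ is hyperbolic relative to $H_1,\dots,H_n$ if $X(G)$ is Gromov hyperbolic. *)

(* Defs.v *)
From HB Require Import structures.
From mathcomp Require Import all_boot all_order all_algebra.
From mathcomp Require Import all_classical all_reals all_analysis.

Set Implicit Arguments.
Unset Strict Implicit.
Unset Printing Implicit Defensive.

Import Order.TTheory GRing.Theory Num.Theory.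
Import numFieldNormedType.Exports.

Local Open Scope classical_set_scope.
Local Open Scope ring_scope.

(* A metric space is given by a type X and a distance function d : X -> X -> R.
   Dimensions live in \bar R: they are infima of sets of natural numbers, hence
   minima, and +oo when there is no such number. *)
Section AsymptoticDimension.
Context {R : realType} {X : Type}.
Variable d : X -> X -> R.

(* The diameter of the empty set is -oo. *)
Definition diameter (A : set X) : \bar R :=
  ereal_sup [set (d p.1 p.2)%:E | p in A `*` A].

Definition bounded_family (D : R) (U : set (set X)) :=
  forall A, U A -> (diameter A <= D%:E)%E.

Definition covers_space (U : set (set X)) := \bigcup_(A in U) A = setT.

Definition multiplicity (r : R) (U : set (set X)) : \bar R :=
  ereal_inf [set k%:R%:E | k in [set k : nat |
    forall B : set X, (diameter B <= r%:E)%E ->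
      ([set A | U A /\ A `&` B !=set0] #<= `I_k)%card]].

Definition asdim : \bar R :=
  ereal_inf [set k%:R%:E | k in [set k : nat |
    forall r : R, 0 < r -> exists D : R, exists U : set (set X),
      [/\ covers_space U, bounded_family D U &
          (multiplicity r U <= k.+1%:R%:E)%E]]].

Definition lasdim : \bar R :=
  ereal_inf [set k%:R%:E | k in [set k : nat |
    exists L : R, \forall r \near +oo, exists U : set (set X),
      [/\ covers_space U, bounded_family (L * r) U &
          (multiplicity r U <= k.+1%:R%:E)%E]]].

Definition gromov_product (w x y : X) : R := (d x w + d y w - d x y) / 2.

Definition gromov_hyperbolic := exists delta : R, forall w x y z : X,
  Num.min (gromov_product w x y) (gromov_product w y z) - delta
    <= gromov_product w x z.

End AsymptoticDimension.

(* A metric graph on the vertex type V is given by a relation E, where E u v l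
   says that an edge of length l joins u and v; only the unordered pair {u, v}
   matters. All graphs below are simple: the length is determined by {u, v}. *)
Section MetricGraph.
Context {R : realType} {V : Type}.
Variable E : V -> V -> R -> Prop.

(* Barycentric coordinates of the point dividing the edge uv in the
   ratio t : 1 - t. *)
Definition edge_point (u v : V) (t : R) : V -> R :=
  fun w => (1 - t) * \1_[set u] w + t * \1_[set v] w.

(* The points of the geometric realization: the vertices, and the points of the
   edges. *)
Definition graph_point : set (V -> R) :=
  [set x | (exists v, x = \1_[set v]) \/
           exists u v l t, [/\ E u v l, 0 <= t <= 1 & x = edge_point u v t]].

Definition graph_space := {x : V -> R | graph_point x}.

(* x and y bound a segment of length a inside a single edge. *)
Definition segment (x y : graph_space) (a : R) := exists u v l s t,
  [/\ E u v l, 0 <= s <= 1, 0 <= t <= 1,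
      sval x = edge_point u v s /\ sval y = edge_point u v t &
      a = l * `|s - t| ].

(* There is a piecewise linear path of length a from x to y. *)
Inductive pl_path : graph_space -> graph_space -> R -> Prop :=
| pl_path_refl x : pl_path x x 0
| pl_path_cons x y z a b : segment x y a -> pl_path y z b -> pl_path x z (a + b).

(* Meaningful for connected graphs only, as inf set0 = 0. *)
Definition path_dist (x y : graph_space) : R := inf [set a | pl_path x y a].

End MetricGraph.

Inductive horoball_edge {R : realType} {V : Type} (adj : V -> V -> Prop) :
    V * nat -> V * nat -> R -> Prop :=
| horoball_vertical v k : horoball_edge adj (v, k) (v, k.+1) 1
| horoball_horizontal v v' k : adj v v' ->
    horoball_edge adj (v, k) (v', k) (expR (- k%:R)).

Section Groups.
Context {G : groupType}.
Local Open Scope group_scope.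

Definition subgroup (A : set G) := group_closed (mem A).

Definition generates (S A : set G) := smallest subgroup S = A.

Definition word_dist (R : realType) (S : set G) (x y : G) : R :=
  inf [set (size w)%:R%R | w in [set w : seq G |
    (forall s, s \in w -> S s \/ S s^-1) /\ x * \prod_(s <- w) s = y]].

(* The Cayley graph is simple: no loops, and a single edge between g and h even
   if both g^-1 * h and its inverse are in S. *)
Definition cayley (S : set G) (g h : G) : Prop :=
  exists s, [/\ S s, s <> 1 & h = g * s].

End Groups.

Section Bowditch.
Context (R : realType) {G : groupType} {n : nat}.
Variables (H : 'I_n -> set G) (S : set G).

(* Vertices of the Bowditch space. Each x : G lies in exactly one left coset of
   H i, so Deep i x k stands for the vertex x at level k.+1 of the horoball glued
   to the coset x H_i; the vertices at level 0 are those of the Cayley graph. *)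
Inductive bowditch_vertex := Base of G | Deep of 'I_n & G & nat.

(* Position of the vertices of the horoball over the Cayley graph of H i in the
   copy glued along g H_i. *)
Definition glue (i : 'I_n) (g : G) (p : H i * nat) : bowditch_vertex :=
  let x := (g * val p.1)%g in if p.2 is k.+1 then Deep i x k else Base x.

(* Two representatives g of the same coset give the same vertices and edges,
   since the Cayley graph of H i is invariant under left translations. *)
Inductive bowditch_edge : bowditch_vertex -> bowditch_vertex -> R -> Prop :=
| bowditch_cayley g h : cayley S g h -> bowditch_edge (Base g) (Base h) 1
| bowditch_horoball i g p q l :
    horoball_edge (fun h h' : H i => cayley (S `&` H i) (val h) (val h')) p q l ->
    bowditch_edge (glue g p) (glue g q) l.

Definition bowditch_space := graph_space bowditch_edge.

Definition bowditch_dist : bowditch_space -> bowditch_space -> R :=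
  path_dist (E := bowditch_edge).

Definition relatively_hyperbolic := gromov_hyperbolic bowditch_dist.

End Bowditch.

Arguments bowditch_dist R {G n} H S x y.

(* Main.v *)
Require Import Defs.
From HB Require Import structures.
From mathcomp Require Import all_boot all_order all_algebra.
From mathcomp Require Import all_classical all_reals all_analysis.
From mathcomp Require Import finmap zify lra.
Local Open Scope classical_set_scope.
Local Open Scope ring_scope.

Set Implicit Arguments.
Unset Strict Implicit.
Unset Printing Implicit Defensive.

Import Order.TTheory GRing.Theory Num.Theory.

(** Hyperbolicity is not needed. A path of length b that starts at height t moves
the foot in G by at most b exp(t + b) letters, and stays in its horoball if
b < t. Hence G embeds coarsely as the base, and the elements of H i, placed at
height t, see at bounded scale the word metric at scale exp t: coverings of X(G)
restrict to coverings of G and to linearly controlled coverings of H i.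

For the upper bound, coverings are replaced by colourings, in which the pieces
of each colour are bounded and far apart. A horoball over H i is coloured with
lasdim(H i) + 2 colours, uniformly over all the cosets; the vertices of bounded
height are coarsely G. The two are combined by merging each deep piece into the
piece of G near it, the latter being coloured at a much larger scale. *)

(** * Coverings and colourings *)

(** Linear control is what makes the horoball bound uniform. At height t, two points that differ by
    a word of length C exp t are joined by a path of length about 2 ln C + 1, whatever t is. Hence
    covers of H i at the scales A exp(j M), with pieces of diameter at most a A exp(j M), give
    pieces of X(G) with one bound for all j. The colour beyond the lasdim(H i) + 1 given ones pays
    for the vertical direction: it separates the covers used at successive scales. Colourings can be
    glued where covers cannot. Each colour is treated on its own, and merging pieces of one colour
    creates no new colour, so the union of two regions costs the maximum of the two numbers of
    colours and not their sum. Extracting k + 1 colours requires a cover at a scale 2(k + 1) times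
    larger; this loss is linear, hence harmless for both dimensions. *)

Lemma ereal_inf_natP (R : realType) (P : set nat) :
  ereal_inf [set k%:R%:E | k in P] = +oo%E :> \bar R \/
  exists2 k, P k & ereal_inf [set k%:R%:E | k in P] = k%:R%:E :> \bar R.
Proof.
have [[k0 Pk0]|P0] := pselect (exists k, P k); last first.
  left; rewrite (_ : [set _ | _ in _] = set0) ?ereal_inf0 //.
  by apply/seteqP; split => // x [k Pk _]; apply: P0; exists k.
right; have exP : exists k, `[<P k>] by exists k0; apply/asboolP.
case: (ex_minnP exP) => k /asboolP Pk kmin; exists k => //.
apply/le_anti/andP; split.
  by apply: ereal_inf_lbound; exists k.
apply: le_ereal_inf_tmp => _ [j Pj <-]; rewrite lee_fin ler_nat.
by apply: kmin; apply/asboolP.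
Qed.

Section Covers.
Context {R : realType} {X : Type}.
Variable d : X -> X -> R.

Lemma diameter_leP (A : set X) (D : R) :
  (diameter d A <= D%:E)%E <-> forall x y, A x -> A y -> d x y <= D.
Proof.
split=> [AD x y Ax Ay|AD].
  rewrite -lee_fin; apply: le_trans AD; apply: ereal_sup_ubound.
  by exists (x, y).
by apply: ge_ereal_sup => _ [[x y] [Ax Ay] <-]; rewrite lee_fin AD.
Qed.

(** From left to right the infimum has to be attained, which holds because it ranges over natural
    numbers. *)
Lemma multiplicity_leP (r : R) (U : set (set X)) (k : nat) :
  (multiplicity d r U <= k%:R%:E)%E <->
  forall B, (diameter d B <= r%:E)%E ->
    ([set A | U A /\ A `&` B !=set0] #<= `I_k)%card.
Proof.
split=> [|Uk]; last by apply: ereal_inf_lbound; exists k.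
rewrite /multiplicity; set P := [set j : nat | _].
have [->|[j Uj ->]] := @ereal_inf_natP R P; first by rewrite leye_eq.
rewrite lee_fin ler_nat => jk B Br; apply: card_le_trans (Uj B Br) _.
by apply: subset_card_le => i /= ij; apply: leq_trans ij jk.
Qed.

Definition has_cover (r D : R) (k : nat) := exists U : set (set X),
  [/\ covers_space U, bounded_family d D U &
      (multiplicity d r U <= k.+1%:R%:E)%E].

Lemma has_coverS r D k l : (k <= l)%N -> has_cover r D k -> has_cover r D l.
Proof.
move=> kl [U [Uc Ub Um]]; exists U; split=> //.
by apply: le_trans Um _; rewrite lee_fin ler_nat.
Qed.

End Covers.

Lemma has_cover_pullback (R : realType) (X Y : Type) (dX : X -> X -> R)
    (dY : Y -> Y -> R) (f : X -> Y) (r r' D D' : R) (k : nat) :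
  (forall x y, dX x y <= r -> dY (f x) (f y) <= r') ->
  (forall x y, dY (f x) (f y) <= D' -> dX x y <= D) ->
  has_cover dY r' D' k -> has_cover dX r D k.
Proof.
move=> fr fD [U [Uc Ub /multiplicity_leP Um]].
exists [set f @^-1` A | A in U]; split.
- apply/seteqP; split => // x _.
  have : [set: Y] (f x) by [].
  by rewrite -Uc => -[A UA Afx]; exists (f @^-1` A) => //; exists A.
- move=> _ [A UA <-]; apply/diameter_leP => x y Ax Ay; apply: fD.
  by have /diameter_leP := Ub A UA; apply.
- apply/multiplicity_leP => B /diameter_leP Br.
  have fB : (diameter dY (f @` B) <= r'%:E)%E.
    apply/diameter_leP => _ _ [x Bx <-] [y By <-].
    by apply: fr; apply: Br.
  apply: card_le_trans _ (Um _ fB).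
  (* Distinct sets [A] may have the same preimage, which can only lower the count. *)
  apply: card_le_trans _ (card_image_le (fun A => f @^-1` A) _).
  apply: subset_card_le => _ [[A UA <-] [x [Ax Bx]]] /=.
  by exists A => //; split=> //; exists (f x); split=> //; exists x.
Qed.

Lemma asdimP (R : realType) (X : Type) (d : X -> X -> R) :
  asdim d = +oo%E \/ exists2 k, asdim d = k%:R%:E &
    forall r : R, 0 < r -> exists D : R, has_cover d r D k.
Proof.
rewrite /asdim; set P := [set j : nat | _].
have [->|[k Pk ->]] := @ereal_inf_natP R P; first by left.
by right; exists k => // r /Pk[D [U HU]]; exists D, U.
Qed.

Lemma lasdimP (R : realType) (X : Type) (d : X -> X -> R) :
  lasdim d = +oo%E \/ exists2 k, lasdim d = k%:R%:E &
    exists L r0 : R, forall r, r0 < r -> has_cover d r (L * r) k.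
Proof.
rewrite /lasdim; set P := [set j : nat | _].
have [->|[k Pk ->]] := @ereal_inf_natP R P; first by left.
right; exists k => //; case: Pk => L [r0 [_ HL]].
by exists L, r0 => r /HL[U HU]; exists U.
Qed.

(* The colour classes c^-1(i) are cut into the pieces c^-1(i) `&` p^-1(q).
   N x y means that x and y are close, B x y that their distance is bounded. *)
Definition colorable (X : Type) (k : nat) (N B : X -> X -> Prop) :=
  exists (c : X -> nat) (p : X -> set X), [/\ forall x, (c x < k)%N,
    forall x y, N x y -> c x = c y -> p x = p y &
    forall x y, c x = c y -> p x = p y -> B x y].

(** Labels of any type can be traded for subsets of [X]: the piece of a point serves as its
    label. *)
Lemma colorable_any (X P : Type) (k : nat) (N B : X -> X -> Prop)
    (c : X -> nat) (p : X -> P) :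
  (forall x, c x < k)%N -> (forall x y, N x y -> c x = c y -> p x = p y) ->
  (forall x y, c x = c y -> p x = p y -> B x y) -> colorable k N B.
Proof.
move=> ck cN cB; exists c, (fun x => [set y | c y = c x /\ p y = p x]).
split=> // x y.
  by move=> /cN Np cxy; rewrite cxy Np.
move=> cxy pxy; apply: cB => //.
have : [set z | c z = c x /\ p z = p x] x by [].
by rewrite pxy => -[].
Qed.

Lemma colorable_sub (X : Type) (k l : nat) (N N' B B' : X -> X -> Prop) :
  (k <= l)%N -> (forall x y, N' x y -> N x y) ->
  (forall x y, B x y -> B' x y) -> colorable k N B -> colorable l N' B'.
Proof.
move=> kl NN BB [c [p [ck cN cB]]]; exists c, p; split=> [x|x y /NN|x y e1 e2].
- exact: leq_trans (ck x) kl.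
- exact: cN.
- by apply: BB; apply: cB.
Qed.

Lemma colorable_pullback (X Y : Type) (f : X -> Y) (k : nat)
    (N B : Y -> Y -> Prop) :
  colorable k N B ->
  colorable k (fun x y => N (f x) (f y)) (fun x y => B (f x) (f y)).
Proof.
move=> [c [p [ck cN cB]]].
apply: (colorable_any (c := c \o f) (p := p \o f)) => [x|x y|x y] /=.
- exact: ck.
- exact: cN.
- exact: cB.
Qed.

Lemma has_cover_of_colorable (R : realType) (X : Type) (d : X -> X -> R)
    (r D : R) (k : nat) :
  colorable k.+1 (fun x y => d x y <= r) (fun x y => d x y <= D) ->
  has_cover d r D k.
Proof.
move=> [c [p [ck cN cB]]].
pose piece x := [set y | c y = c x /\ p y = p x].
exists (range piece); split.
- by apply/seteqP; split => // x _; exists (piece x) => //; exists x.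
- move=> _ [x _ <-]; apply/diameter_leP => y z [cy py] [cz pz].
  by apply: cB; rewrite ?cy ?cz ?py ?pz.
- apply/multiplicity_leP => B /diameter_leP Br.
  (* [g i] rebuilds, from the colour alone, the only piece of colour i that can meet [B]; so the
     pieces meeting [B] are among k + 1 sets. *)
  pose g i := [set z | c z = i /\ exists y, [/\ B y, c y = i & p z = p y]].
  apply: card_le_trans _ (card_image_le g `I_k.+1).
  apply: subset_card_le => _ [[x _ <-] [y [[/= cy py] By]]] /=.
  exists (c y) => //=; apply/seteqP; split => z.
    move=> [cz [w [Bw cw pz]]]; split; first by rewrite cz.
    by rewrite pz -py; apply: cN => //; apply: Br.
  by move=> [/= cz pz]; split; rewrite ?cz ?cy //; exists y; split=> //; rewrite py.
Qed.

(* The sets of U at distance at most t rho from x form a family N t x, of size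
   between 1 and k+1 for t <= k+1, hence constant between some t and t+1. The
   colour of x is the size of this N t x, and its piece is N t x itself. *)
Lemma colorable_of_has_cover (R : realType) (X : Type) (d : X -> X -> R)
    (rho D : R) (k : nat) :
  (forall x, d x x = 0) -> (forall x y, d x y = d y x) ->
  (forall x y z, d x z <= d x y + d y z) -> 0 <= rho ->
  has_cover d (2 * (k.+1%:R * rho)) D k ->
  colorable k.+1 (fun x y => d x y <= rho)
    (fun x y => d x y <= D + 2 * (k.+1%:R * rho)).
Proof.
move=> d0 dC dT rho0 [U [Uc Ub /multiplicity_leP Um]].
pose N t x := [set A | U A /\ exists2 a, A a & d x a <= t%:R * rho].
have Nk t x : (t <= k.+1)%N -> (N t x #<= `I_k.+1)%card.
  (* The diameter of this ball is at most twice its radius, which is why the cover is taken at scale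
     2 (k + 1) rho. *)
  move=> tk; pose B := [set a | d x a <= k.+1%:R * rho].
  apply: card_le_trans (Um B _); last first.
    apply/diameter_leP => y z By Bz; apply: le_trans (dT y x z) _.
    by rewrite mulr_natl mulr2n lerD // dC.
  apply: subset_card_le => A [UA [a Aa xa]]; split=> //; exists a; split=> //.
  by apply: le_trans xa _; rewrite ler_wpM2r // ler_nat.
have Nfin t x : (t <= k.+1)%N -> finite_set (N t x).
  by move=> /Nk/card_le_finite; apply; exact: finite_II.
pose n t x := #|` fset_set (N t x)|%fset.
have nk t x : (t <= k.+1)%N -> (n t x <= k.+1)%N.
  by move=> tk; apply: geq_card_fset_set; apply: Nk.
have Nsub t t' x y : d x y <= rho *+ (t' - t) -> (t <= t')%N ->
    N t x `<=` N t' y.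
  move=> xy tt A [UA [a Aa xa]]; split=> //; exists a => //.
  apply: le_trans (dT y x a) _; rewrite dC.
  by rewrite -(subnK tt) natrD mulrDl lerD // mulr_natl.
have NS t x : N t x `<=` N t.+1 x.
  by apply: Nsub; rewrite ?subSnn ?mulr1n ?d0.
have neq t t' x y : (t <= k.+1)%N -> (t' <= k.+1)%N -> N t x `<=` N t' y ->
    (n t' y <= n t x)%N -> N t x = N t' y.
  move=> tk tk' sub le.
  apply: fset_set_inj; rewrite ?inE; [exact: Nfin..|].
  apply/eqP; rewrite eqEfcard le andbT -fset_set_sub //; exact: Nfin.
have n0 x : (0 < n 0 x)%N.
  rewrite /n lt0n cardfs_eq0; apply/negP => /eqP e.
  have : [set: X] x by [].
  rewrite -Uc => -[A UA Ax].
  have : A \in fset_set (N 0%N x).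
    rewrite in_fset_set; last exact: Nfin.
    by apply: mem_set; split=> //; exists x; rewrite ?d0 ?mul0r.
  by rewrite e inE.
(* Otherwise the sizes would increase strictly from at least 1 at t = 0, and exceed k + 1 at t = k +
   1. *)
have stab x : exists t, (t <= k)%N /\ N t x = N t.+1 x.
  apply: contrapT => /forallNP H.
  have : forall t, (t <= k.+1)%N -> (t < n t x)%N.
    elim=> [//|t IH] tk.
    apply: leq_ltn_trans (IH (ltnW tk)) _; rewrite ltnNge.
    by apply/negP => le; apply: (H t); split=> //; apply: neq => //; apply: ltnW.
  by move=> /(_ _ (leqnn _)); rewrite ltnNge nk.
have [t tP] := choice stab.
have tk x : (t x <= k.+1)%N by case: (tP x) => /leqW.
have npos x : (0 < n (t x) x)%N.
  apply: leq_trans (n0 x) _; apply: fsubset_leq_card.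
  rewrite -fset_set_sub; [|exact: Nfin..].
  by apply: Nsub; rewrite // d0 mulrn_wge0.
apply: (colorable_any (c := fun x => (n (t x) x).-1) (p := fun x => N (t x) x)).
- by move=> x; rewrite -ltnS prednK // ltnS nk.
(* If t x <= t y, then N (t x) x lies in N (t y + 1) y, which is N (t y) y by stability at y; equal
   sizes then force equality. *)
- suff wl x y : d x y <= rho -> (n (t x) x).-1 = (n (t y) y).-1 ->
      (t x <= t y)%N -> N (t x) x = N (t y) y.
    move=> x y xy cxy; case: (leqP (t x) (t y)) => [|/ltnW] le; first exact: wl.
    by apply/esym/wl => //; rewrite dC.
  move=> xy cxy le; have nxy : n (t x) x = n (t y) y.
    by rewrite -(prednK (npos x)) cxy prednK.
  apply: neq => //; last by rewrite nxy.
  have [_ ->] := tP y; apply: Nsub; last exact: leqW.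
  by rewrite subSn // (le_trans xy) // mulrS lerDl mulrn_wge0.
- move=> x y _ pxy.
  have [A [UA [a Aa xa]]] : exists A, N (t x) x A.
    apply: contrapT => /forallNP H; have := npos x; rewrite /n.
    suff -> : N (t x) x = set0 by rewrite fset_set0 cardfs0.
    by apply/seteqP; split => // A /H.
  have [_ [b Ab yb]] : N (t y) y A by rewrite -pxy; split=> //; exists a.
  have tr z : (t z)%:R * rho <= k.+1%:R * rho by rewrite ler_wpM2r // ler_nat.
  have := dT x a y; have := dT a b y; rewrite (dC b y).
  have /diameter_leP /(_ a b Aa Ab) := Ub A UA.
  have := tr x; have := tr y; move: xa yb; lra.
Qed.

(* A piece of A that comes close to a piece of the same colour outside A is
   merged into it; by the hypothesis absorbed, there is at most one. *)
Lemma colorable_absorb (X P : Type) (k : nat) (N B : X -> X -> Prop)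
    (A : set X) (c : X -> nat) (pA pB : X -> P) :
  let joined x y := x = y \/ A x /\ exists x',
    [/\ A x', c x' = c x, pA x' = pA x & N x' y] in
  forall (ck : forall x, (c x < k)%N)
    (NC : forall x y, N x y -> N y x)
    (disjA : forall x y, A x -> A y -> N x y -> c x = c y -> pA x = pA y)
    (disjB : forall x y, ~ A x -> ~ A y -> N x y -> c x = c y -> pB x = pB y)
    (absorbed : forall x x' y y', A x -> A x' -> ~ A y -> ~ A y' ->
      c x' = c x -> c y = c x -> c y' = c x -> pA x = pA x' ->
      N x y -> N x' y' -> pB y = pB y')
    (bndA : forall x y, A x -> A y -> c x = c y -> pA x = pA y -> B x y)
    (bndB : forall x y z w, ~ A z -> ~ A w -> c y = c x -> c z = c x ->
      c w = c x -> pB z = pB w -> joined x z -> joined y w -> B x y),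
  colorable k N B.
Proof.
move=> joined ck NC disjA disjB absorbed bndA bndB.
pose close_piece i q := [set y | [/\ ~ A y, c y = i & exists x',
  [/\ A x', c x' = i, pA x' = q & N x' y]]].
(* The choice depends on the set only, so points of [A] with the same colour and label get the same
   host. *)
pose choose (T : set X) : option X :=
  if pselect (exists y, T y) is left Ty then Some (projT1 (cid Ty)) else None.
have chooseP T y : choose T = Some y -> T y.
  by rewrite /choose; case: pselect => // Ty [<-]; case: cid.
have chooseN T y : T y -> exists2 z, choose T = Some z & T z.
  rewrite /choose; case: pselect => [Ty _|H Ty]; last by case: H; exists y.
  by case: cid => z Tz; exists z.
pose host x := if pselect (A x) then choose (close_piece (c x) (pA x)) else Some x.
have hostA x : A x -> host x = choose (close_piece (c x) (pA x)).
  by rewrite /host; case: pselect.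
have hostB x : ~ A x -> host x = Some x.
  by rewrite /host; case: pselect.
have hostP x z : host x = Some z -> [/\ ~ A z, c z = c x & joined x z].
  have [Ax|NAx] := pselect (A x).
    rewrite hostA // => /chooseP[NAz cz [x' x'P]]; split=> //.
    by right; split=> //; exists x'.
  by rewrite hostB // => -[<-]; split=> //; left.
(* A piece of [A] with nothing of its colour nearby outside [A] keeps its own label, in the other
   summand, so it cannot collide with an outer piece. *)
pose q x := if host x is Some y then inr (pB y) else inl (pA x).
have NAB x y : A x -> ~ A y -> N x y -> c x = c y -> q x = q y.
  move=> Ax NAy Nxy cxy; rewrite /q (hostB y) // hostA //.
  have Ty : close_piece (c x) (pA x) y by split=> //; exists x.
  have [z -> [NAz cz [x' [Ax' cx' px' Nz]]]] := chooseN _ _ Ty.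
  by congr inr; apply: (absorbed x' x) => //; rewrite ?cx'.
apply: (colorable_any (c := c) (p := q)) => // x y.
- move=> Nxy cxy.
  have [Ax|NAx] := pselect (A x); have [Ay|NAy] := pselect (A y).
  + by rewrite /q !hostA // cxy (disjA x y).
  + exact: NAB.
  + by apply/esym/NAB => //; apply: NC.
  + by rewrite /q !hostB // (disjB x y).
- move=> cxy; rewrite /q.
  case hx: (host x) => [z|]; case hy: (host y) => [w|] //.
    have [NAz cz xz] := hostP _ _ hx; have [NAw cw yw] := hostP _ _ hy.
    by move=> -[pzw]; apply: (bndB x y z w) => //; rewrite cw.
  have Asome u : host u = None -> A u.
    by have [//|NAu] := pselect (A u); rewrite hostB.
  by move=> -[pxy]; apply: bndA => //; apply: Asome.
Qed.

(** * Paths in metric graphs *)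

Section GraphPaths.
Context {R : realType} {V : Type}.
Variable E : V -> V -> R -> Prop.
Hypothesis E_loopless : forall u v l, E u v l -> u <> v.
Hypothesis E_length : forall u v l, E u v l -> 0 <= l <= 1.
Let adj u v l := E u v l \/ E v u l.
Hypothesis E_uniq : forall u v l l', adj u v l -> adj u v l' -> l = l'.

Inductive edge_path : V -> V -> R -> Prop :=
| edge_path_nil u : edge_path u u 0
| edge_path_cons u v w l a :
    E u v l \/ E v u l -> edge_path v w a -> edge_path u w (l + a).

(** A witness replaces the infimum, so that closeness can be followed edge by edge; the path
    distance is recovered up to an additive 1. *)
Definition path_within (a : R) (u v : V) := exists2 b, edge_path u v b & b <= a.

Definition vertex (v : V) : graph_space E :=
  exist _ \1_[set v] (or_introl (ex_intro _ v erefl)).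

Lemma adj_loopless u v l : adj u v l -> u <> v.
Proof. by move=> [/E_loopless//|/E_loopless H e]; apply: H. Qed.

Lemma adj_ge0 u v l : adj u v l -> 0 <= l.
Proof. by move=> [] /E_length/andP[]. Qed.

Lemma edge_path_ge0 u v a : edge_path u v a -> 0 <= a.
Proof.
by elim=> // {}u {}v w l {}a /adj_ge0 l0 _; exact: addr_ge0.
Qed.

Lemma edge_path_cat u v w a b :
  edge_path u v a -> edge_path v w b -> edge_path u w (a + b).
Proof.
elim=> [|{}u {}v v' l {}a uv _ IH] vw; first by rewrite add0r.
by rewrite -addrA; apply: edge_path_cons uv _; apply: IH.
Qed.

Lemma edge_path_sym u v a : edge_path u v a -> edge_path v u a.
Proof.
elim=> [{}u|{}u {}v w l {}a uv _ IH]; first exact: edge_path_nil.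
rewrite addrC; apply: edge_path_cat IH _; rewrite -[l]addr0.
apply: edge_path_cons (edge_path_nil _); tauto.
Qed.

Lemma path_within_refl u a : 0 <= a -> path_within a u u.
Proof. by exists 0 => //; exact: edge_path_nil. Qed.

Lemma path_within_sym u v a : path_within a u v -> path_within a v u.
Proof. by move=> [b /edge_path_sym uv ba]; exists b. Qed.

Lemma path_within_trans u v w a b :
  path_within a u v -> path_within b v w -> path_within (a + b) u w.
Proof.
move=> [a' uv aa] [b' vw bb]; exists (a' + b'); last exact: lerD.
exact: edge_path_cat uv vw.
Qed.

Lemma path_within_le a b u v : a <= b -> path_within a u v -> path_within b u v.
Proof. by move=> ab [c uv ca]; exists c => //; apply: le_trans ca ab. Qed.

Lemma path_within_ge0 a u v : path_within a u v -> 0 <= a.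
Proof. by move=> [b /edge_path_ge0 b0 ba]; exact: le_trans b0 ba. Qed.

Lemma path_within_edge u v l a : E u v l -> l <= a -> path_within a u v.
Proof.
move=> uv la; exists l => //; rewrite -[l]addr0.
by apply: edge_path_cons (edge_path_nil _); left.
Qed.

Lemma indic_self (v : V) : \1_[set v] v = 1 :> R.
Proof. by rewrite indicE mem_set. Qed.

Lemma indic_neq (v w : V) : w <> v -> \1_[set v] w = 0 :> R.
Proof. by move=> wv; rewrite indicE memNset. Qed.

Lemma indic_inj (v w : V) : \1_[set v] = \1_[set w] :> (V -> R) -> v = w.
Proof.
move=> /(congr1 (fun f => f v)); rewrite indic_self => e.
apply: contrapT => vw; move: e; rewrite indic_neq // => /eqP.
by rewrite oner_eq0.
Qed.

Lemma edge_point0 (u v : V) : edge_point u v 0 = \1_[set u] :> (V -> R).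
Proof. by apply/funext => w; rewrite /edge_point subr0 mul1r mul0r addr0. Qed.

Lemma edge_pointC (u v : V) (t : R) : edge_point u v t = edge_point v u (1 - t).
Proof. by apply/funext => w; rewrite /edge_point subKr addrC. Qed.

Lemma edge_point1 (u v : V) : edge_point u v 1 = \1_[set v] :> (V -> R).
Proof. by rewrite edge_pointC subrr edge_point0. Qed.

Lemma edge_point_src (u v : V) (t : R) : u <> v -> edge_point u v t u = 1 - t.
Proof. by move=> uv; rewrite /edge_point indic_self indic_neq // mulr1 mulr0 addr0. Qed.

Lemma edge_point_tgt (u v : V) (t : R) : u <> v -> edge_point u v t v = t.
Proof.
move=> uv; rewrite edge_pointC edge_point_src ?subKr // => e; exact: uv.
Qed.

Lemma edge_point_out (u v w : V) (t : R) :
  edge_point u v t w <> 0 -> w = u \/ w = v.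
Proof.
move=> e; apply: contrapT => /not_orP[wu wv]; apply: e.
by rewrite /edge_point !indic_neq // !mulr0 addr0.
Qed.

Lemma edge_point_indic (u v w : V) (t : R) : u <> v ->
  edge_point u v t = \1_[set w] -> (u = w /\ t = 0) \/ (v = w /\ t = 1).
Proof.
move=> uv e.
have : edge_point u v t w <> 0 by rewrite e indic_self; apply/eqP/oner_neq0.
move=> /edge_point_out[wu|wv]; [left|right]; split=> //.
  by have := congr1 (fun f => f v) e; rewrite /= edge_point_tgt // indic_neq // wu => /esym.
have := congr1 (fun f => f v) e.
by rewrite /= edge_point_tgt // -wv indic_self.
Qed.

(** The support of an interior point is the pair of ends of its edge, and the parameter is a
    coordinate. *)
Lemma edge_point_eq (u v u' v' : V) (t t' : R) : u <> v -> u' <> v' ->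
  0 < t < 1 -> edge_point u v t = edge_point u' v' t' ->
  [/\ u = u', v = v' & t = t'] \/ [/\ u = v', v = u' & t = 1 - t'].
Proof.
move=> uv uv' /andP[t0 t1] e.
have eu := congr1 (fun f => f u) e; have ev := congr1 (fun f => f v) e.
rewrite /= edge_point_src // in eu; rewrite /= edge_point_tgt // in ev.
have : edge_point u' v' t' u <> 0 by rewrite -eu; lra.
have : edge_point u' v' t' v <> 0 by rewrite -ev; lra.
move=> /edge_point_out[vu'|vv'] /edge_point_out[uu'|uv''].
- by case: uv; rewrite vu' uu'.
- by right; split=> //; rewrite ev vu' edge_point_src.
- by left; split=> //; rewrite ev vv' edge_point_tgt.
- by case: uv; rewrite vv' uv''.
Qed.

(** The invariant along a piecewise linear path: [w] is the vertex reached by an edge path, [s] the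
    length from [w] to [x] inside one edge. The first alternative also covers isolated vertices. *)
Let at_offset (x : graph_space E) w s := sval x = \1_[set w] /\ s = 0 \/
  exists v l t, [/\ adj w v l, 0 <= t <= 1, sval x = edge_point w v t & s = l * t].

Lemma segment_vertex (x y : graph_space E) w a :
  sval x = \1_[set w] -> segment x y a -> at_offset y w a.
Proof.
move=> xw [u [v [l [s [t [uv s01 /andP[t0 t1] [xs yt] ->]]]]]].
right; have := edge_point_indic (E_loopless uv) (etrans (esym xs) xw).
move=> [[<- ->]|[<- ->]].
  exists v, l, t; split=> //; [by left|by rewrite t0|].
  by rewrite sub0r normrN ger0_norm.
exists u, l, (1 - t); split=> //; [by right|lra|by rewrite yt edge_pointC|].
by rewrite ger0_norm // subr_ge0.
Qed.

(** The edge path lags behind the point. Inside an edge only the offset changes; another edge can be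
    entered only at an end, and at the far end the offset pays for the whole edge. *)
Lemma at_offset_segment (x y : graph_space E) w s a :
  at_offset x w s -> segment x y a -> exists w' b s',
    [/\ edge_path w w' b, at_offset y w' s' & b + s' <= s + a].
Proof.
move=> [[xw ->] /(segment_vertex xw) yw|].
  by exists w, 0, a; split=> //; exact: edge_path_nil.
move=> [v [l [t [wv /andP[t0 t1] xt ->]]]] xy.
have l0 := adj_ge0 wv.
have [/eqP te|tn0] := boolP (t == 0).
  have /segment_vertex /(_ xy) yw : sval x = \1_[set w].
    by rewrite xt te edge_point0.
  by exists w, 0, a; split=> //; [exact: edge_path_nil|rewrite te mulr0].
have [/eqP te|tn1] := boolP (t == 1).
  have /segment_vertex /(_ xy) yv : sval x = \1_[set v].
    by rewrite xt te edge_point1.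
  exists v, l, a; split=> //; last by rewrite te mulr1.
  by rewrite -[l]addr0; apply: edge_path_cons (edge_path_nil _).
have t01 : 0 < t < 1 by rewrite !lt_neqAle t0 t1 eq_sym tn0 tn1.
(* An interior point determines its edge, so the segment stays in the edge of [x], in one of the two
   orientations. *)
case: xy => [u [v' [l' [s1 [t' [uv s01 /andP[t'0 t'1] [xs yt] ->]]]]]].
have := edge_point_eq (adj_loopless wv) (E_loopless uv) t01 (etrans (esym xt) xs).
have lel : forall r, l * r <= l * t + l * `|t - r|.
  move=> r; rewrite -mulrDr ler_wpM2l //; have := ler_norm (- (t - r)).
  by rewrite normrN; lra.
move=> [] [? ? ts]; subst.
- have <- : l = l' by apply: E_uniq wv _; left.
  exists u, 0, (l * t'); split; [exact: edge_path_nil| |by rewrite add0r].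
  by right; exists v', l, t'; split; rewrite // t'0.
- have <- : l = l' by apply: E_uniq wv _; right.
  exists v', 0, (l * (1 - t')); split; [exact: edge_path_nil| |].
    by right; exists u, l, (1 - t'); split; rewrite // -?edge_pointC //; lra.
  rewrite add0r (_ : s1 - t' = - (1 - s1 - (1 - t'))) ?normrN ?lel //.
  by lra.
Qed.

Lemma at_offset_path (x y : graph_space E) w s a :
  pl_path x y a -> at_offset x w s -> exists w' b s',
    [/\ edge_path w w' b, at_offset y w' s' & b + s' <= s + a].
Proof.
move=> xy; elim: xy w s => [{}x|{}x {}y z b {}a xy _ IH] w s xw.
  by exists w, 0, s; split=> //; [exact: edge_path_nil|rewrite add0r addr0].
have [w1 [b1 [s1 [ww1 yw1 le1]]]] := at_offset_segment xw xy.
have [w2 [b2 [s2 [ww2 yw2 le2]]]] := IH _ _ yw1.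
exists w2, (b1 + b2), s2; split=> //; first exact: edge_path_cat ww1 ww2.
by move: le1 le2; lra.
Qed.

Lemma path_within_of_pl_path u v a :
  pl_path (vertex u) (vertex v) a -> path_within a u v.
Proof.
move=> /at_offset_path /(_ (or_introl (conj erefl erefl))).
move=> [w [b [s [uw vw]]]]; rewrite add0r => le.
case: vw => [[/indic_inj -> s0]|[v' [l [t [wv' _ e st]]]]].
  by exists b => //; rewrite (le_trans _ le) // s0 addr0.
(* The final vertex is [w] or the far end of the edge; in the second case the offset is the length
   of one last edge. *)
have [[<- t0]|[<- t1]] := edge_point_indic (adj_loopless wv') (esym e).
  by exists b => //; rewrite (le_trans _ le) // st t0 mulr0 addr0.
exists (b + (s + 0)); last by rewrite addr0.
apply: edge_path_cat uw _; rewrite st t1 mulr1.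
exact: edge_path_cons (edge_path_nil _).
Qed.

Lemma segment_sym (x y : graph_space E) a : segment x y a -> segment y x a.
Proof.
move=> [u [v [l [s [t [uv s01 t01 [xs yt] ->]]]]]].
by exists u, v, l, t, s; rewrite distrC.
Qed.

Lemma segment_ge0 (x y : graph_space E) a : segment x y a -> 0 <= a.
Proof.
move=> [u [v [l [s [t [uv _ _ _ ->]]]]]]; apply: mulr_ge0 => //.
by have /andP[] := E_length uv.
Qed.

Lemma pl_path_ge0 (x y : graph_space E) a : pl_path x y a -> 0 <= a.
Proof. by elim=> // {}x {}y z b {}a /segment_ge0 b0 _; exact: addr_ge0. Qed.

Lemma pl_path_segment (x y : graph_space E) a : segment x y a -> pl_path x y a.
Proof. by move=> xy; rewrite -[a]addr0; apply: pl_path_cons xy (pl_path_refl _). Qed.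

Lemma pl_path_cat (x y z : graph_space E) a b :
  pl_path x y a -> pl_path y z b -> pl_path x z (a + b).
Proof.
elim=> [|{}x {}y y' l {}a xy _ IH] yz; first by rewrite add0r.
by rewrite -addrA; apply: pl_path_cons xy _; apply: IH.
Qed.

Lemma pl_path_sym (x y : graph_space E) a : pl_path x y a -> pl_path y x a.
Proof.
elim=> [{}x|{}x {}y z l {}a xy _ IH]; first exact: pl_path_refl.
rewrite addrC; apply: pl_path_cat IH _.
by apply: pl_path_segment; apply: segment_sym.
Qed.

Lemma segment_edge u v l : E u v l -> segment (vertex u) (vertex v) l.
Proof.
move=> uv; exists u, v, l, 0, 1; split; rewrite ?lexx ?ler01 //=.
  by rewrite edge_point0 edge_point1.
by rewrite sub0r normrN normr1 mulr1.
Qed.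

Lemma pl_path_of_edge_path u v a :
  edge_path u v a -> pl_path (vertex u) (vertex v) a.
Proof.
elim=> [{}u|{}u {}v w l {}a uv _ IH]; first exact: pl_path_refl.
apply: pl_path_cons IH; case: uv => /segment_edge //.
exact: segment_sym.
Qed.

Lemma pl_path_to_vertex (x : graph_space E) :
  exists v a, pl_path x (vertex v) a /\ a <= 1.
Proof.
case: x => f gf; have [[v fv]|[u [v [l [t [uv t01 ft]]]]]] := gf.
  exists v, 0; split=> //; rewrite [exist _ _ _](_ : _ = vertex v).
    exact: pl_path_refl.
  exact: eq_exist.
exists u, (l * `|t - 0|); split.
  apply: pl_path_segment; exists u, v, l, t, 0.
  by split; rewrite ?lexx ?ler01 //= edge_point0.
have /andP[l0 l1] := E_length uv; have /andP[t0 t1] := t01.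
by rewrite subr0 ger0_norm // mulr_ile1.
Qed.

Lemma path_dist_le (x y : graph_space E) a : pl_path x y a -> path_dist x y <= a.
Proof.
by move=> xy; apply: ge_inf => //; exists 0 => b /pl_path_ge0.
Qed.

Hypothesis E_connected : forall u v, exists a, edge_path u v a.

(** Connectedness excludes the default value of [inf] on the empty set. The infimum need not be
    attained, whence the slack 1. *)
Lemma pl_path_of_dist (x y : graph_space E) D :
  path_dist x y <= D -> exists2 a, pl_path x y a & a <= D + 1.
Proof.
move=> xyD; have [u [a [xu _]]] := pl_path_to_vertex x.
have [v [b [yv _]]] := pl_path_to_vertex y; have [c uv] := E_connected u v.
have : exists2 e, [set a | pl_path x y a] e & e < inf [set a | pl_path x y a] + 1.
  apply: inf_adherent => //; split; last by exists 0 => e /pl_path_ge0.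
  exists (a + (c + b)); apply: pl_path_cat xu _.
  by apply: pl_path_cat (pl_path_sym yv); apply: pl_path_of_edge_path.
move=> [e xye lte]; exists e => //; apply: ltW; apply: lt_le_trans lte _.
by rewrite lerD2r.
Qed.

Lemma path_within_of_dist u v D :
  path_dist (vertex u) (vertex v) <= D -> path_within (D + 1) u v.
Proof.
move=> /pl_path_of_dist[a /path_within_of_pl_path uv aD]; exact: path_within_le uv.
Qed.

Lemma path_dist_of_within u v D :
  path_within D u v -> path_dist (vertex u) (vertex v) <= D.
Proof. by move=> [a /pl_path_of_edge_path/path_dist_le]; exact: le_trans. Qed.

(** Each point moves by at most 1 to a vertex, which costs 2 for a pair; passing from an infimum to
    a path costs 1 more. *)
Lemma nearest_vertex : exists nu : graph_space E -> V,
  (forall x y D, path_dist x y <= D -> path_within (D + 3) (nu x) (nu y)) /\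
  (forall x y D, path_within D (nu x) (nu y) -> path_dist x y <= D + 2).
Proof.
have [nu nuP] := choice pl_path_to_vertex; exists nu; split=> x y D.
- move=> /pl_path_of_dist[a xy aD].
  have [b [xb b1]] := nuP x; have [c [yc c1]] := nuP y.
  have := pl_path_cat (pl_path_sym xb) (pl_path_cat xy yc).
  by move=> /path_within_of_pl_path; apply: path_within_le; move: b1 c1 aD; lra.
- move=> [a /pl_path_of_edge_path xy aD].
  have [b [xb b1]] := nuP x; have [c [yc c1]] := nuP y.
  have := pl_path_cat xb (pl_path_cat xy (pl_path_sym yc)).
  by move=> /path_dist_le/le_trans; apply; move: b1 c1 aD; lra.
Qed.

End GraphPaths.

(** * Word metrics *)

Section Words.
Context {R : realType} {G : groupType}.
Implicit Types (S T A : set G) (x y z g : G) (w : seq G) (a b : R).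
Local Open Scope group_scope.

Definition word_within (S : set G) (x y : G) (a : R) := exists w : seq G,
  [/\ forall s, s \in w -> S s \/ S s^-1, x * \prod_(s <- w) s = y &
      ((size w)%:R <= a)%R].

(** Word lengths are natural numbers, so the infimum is attained once some word exists; without one
    it would be the default value 0. *)
Lemma word_distP S x y a : (exists b, word_within S x y b) ->
  (word_dist R S x y <= a)%R <-> word_within S x y a.
Proof.
move=> [b [w0 [w0S w0P _]]]; rewrite /word_dist; set L := [set _ | _ in _].
have L0 : lbound L 0%R by move=> _ [w _ <-].
split=> [La|[w [wS wP wa]]]; last first.
  by apply: le_trans wa; apply: ge_inf; [exists 0%R|exists w].
pose P n := `[<exists w, [/\ forall s, s \in w -> S s \/ S s^-1,
  x * \prod_(s <- w) s = y & size w = n]>].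
have exP : exists n, P n by exists (size w0); apply/asboolP; exists w0.
case: (ex_minnP exP) => n /asboolP[w [wS wP wn]] nmin.
exists w; split=> //; apply: le_trans La.
apply: lb_le_inf; first by exists (size w0)%:R%R; exists w0.
move=> _ [v [vS vP] <-]; rewrite ler_nat wn; apply: nmin.
by apply/asboolP; exists v.
Qed.

Lemma word_within_refl S x a : (0 <= a)%R -> word_within S x x a.
Proof. by move=> a0; exists [::]; split; rewrite // big_nil mulg1. Qed.

Lemma word_within_le S x y a b :
  (a <= b)%R -> word_within S x y a -> word_within S x y b.
Proof.
by move=> ab [w [wS wP wa]]; exists w; split=> //; apply: le_trans ab.
Qed.

Lemma word_within_translate S g x y a :
  word_within S x y a -> word_within S (g * x) (g * y) a.
Proof. by move=> [w [wS <- wa]]; exists w; split=> //; rewrite mulgA. Qed.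

Lemma prod_seq_cat w w' :
  \prod_(s <- w ++ w') s = (\prod_(s <- w) s) * \prod_(s <- w') s.
Proof. by elim: w => [|s w IH]; rewrite ?big_nil ?mul1g // !big_cons IH mulgA. Qed.

Lemma word_within_trans S x y z a b : word_within S x y a ->
  word_within S y z b -> word_within S x z (a + b)%R.
Proof.
move=> [w [wS <- wa]] [v [vS <- vb]]; exists (w ++ v); split.
- by move=> s; rewrite mem_cat => /orP[/wS|/vS].
- by rewrite prod_seq_cat mulgA.
- by rewrite size_cat natrD lerD.
Qed.

Lemma word_within_letter S x s : S s -> word_within S x (x * s) 1%R.
Proof.
move=> Ss; exists [:: s]; rewrite big_cons big_nil mulg1; split=> // t.
by rewrite inE => /eqP ->; left.
Qed.

Lemma word_within_letterV S x s : S s^-1 -> word_within S x (x * s) 1%R.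
Proof.
move=> Ss; exists [:: s]; rewrite big_cons big_nil mulg1; split=> // t.
by rewrite inE => /eqP ->; right.
Qed.

(** [P] is obtained at the exact length of a word, so it need not be monotone in its last
    argument. *)
Lemma word_within_ind S (P : G -> G -> R -> Prop) :
  (forall x, P x x 0%R) ->
  (forall x s y a, S s \/ S s^-1 -> P (x * s) y a -> P x y (1 + a)%R) ->
  forall x y a, word_within S x y a -> exists2 b, (b <= a)%R & P x y b.
Proof.
move=> P0 PS x y a [w [wS wP wa]]; exists (size w)%:R%R => //.
elim: w x wS wP {wa a} => [|s w IH] x wS.
  by rewrite big_nil mulg1 => ->; exact: P0.
rewrite big_cons mulgA => wP /=; rewrite -natr1 addrC.
apply: PS (wS s _) _; rewrite ?inE ?eqxx //; apply: IH => // t tw.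
by apply: wS; rewrite inE tw orbT.
Qed.

Lemma word_within_sym S x y a : word_within S x y a -> word_within S y x a.
Proof.
move=> /(@word_within_ind S (fun x y a => word_within S y x a)).
case=> [{}x|{}x s {}y {}a Ss yx|b ba /(word_within_le ba)//].
  exact: word_within_refl.
rewrite addrC; apply: word_within_trans yx _; rewrite -{2}[x](mulgK s).
case: Ss => Ss; [apply: word_within_letterV|exact: word_within_letter].
by rewrite invgK.
Qed.

Lemma subgroup1 A : subgroup A -> A 1.
Proof. by move=> [/set_mem]. Qed.

Lemma subgroupV A x : subgroup A -> A x -> A x^-1.
Proof.
move=> [A1 AB] Ax; apply: set_mem; rewrite -[x^-1]mul1g.
by apply: AB => //; exact: mem_set.
Qed.

Lemma subgroupM A x y : subgroup A -> A x -> A y -> A (x * y).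
Proof.
move=> sA Ax Ay; apply: set_mem; rewrite -[y]invgK.
by apply: sA.2; apply: mem_set => //; exact: subgroupV.
Qed.

Lemma word_within_subgroup S A x y a : subgroup A -> S `<=` A ->
  word_within S x y a -> A (x^-1 * y).
Proof.
move=> sA SA /(@word_within_ind S (fun x y _ => A (x^-1 * y))).
case=> // [z|z s t _ Ss]; first by rewrite mulVg; exact: subgroup1.
rewrite invgM -mulgA => At; rewrite -[_ * t](mulVKg s); apply: subgroupM => //.
by case: Ss => /SA // /(subgroupV sA); rewrite invgK.
Qed.

Lemma generates_sub S A : generates S A -> S `<=` A.
Proof. by move=> <-; exact: sub_gen_smallest. Qed.

Lemma generates_word S A g : generates S A -> A g ->
  exists a, word_within S 1 g a.
Proof.
(* The elements reached from 1 by a word form a subgroup containing [S]. *)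
move=> <-; pose W := [set g | exists a, word_within S 1 g a].
have sW : subgroup W.
  split; first by apply: mem_set; exists 0%R; exact: word_within_refl.
  move=> u v /set_mem[a ua] /set_mem[b vb]; apply: mem_set; exists (a + b)%R.
  apply: word_within_trans ua _; apply: word_within_sym.
  rewrite -{2}[u](mulgVK v).
  by have := word_within_translate (u * v^-1) vb; rewrite mulg1 -mulgA.
have SW : S `<=` W.
  by move=> s Ss; exists 1%R; have := word_within_letter 1 Ss; rewrite mul1g.
by move=> /(smallest_sub sW SW).
Qed.

Lemma word_within_connected S A x y : subgroup A -> generates S A ->
  A x -> A y -> exists a, word_within S x y a.
Proof.
move=> sA SA Ax Ay; have [a xya] := generates_word SA (subgroupM sA (subgroupV sA Ax) Ay).
exists a; have := word_within_translate x xya.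
by rewrite mulg1 mulVKg.
Qed.

(** [C] bounds the lengths over [T] of the finitely many letters of [S], which are substituted one
    by one. *)
Lemma word_within_change S T : finite_set S ->
  (forall s, S s -> exists a, word_within T 1 s a) ->
  exists2 C, (1 <= C)%R &
    forall x y a, word_within S x y a -> word_within T x y (C * a)%R.
Proof.
move=> /finite_seqP[l ->] lT.
have [C C1 HC] : exists2 C, (1 <= C)%R &
    forall s, s \in l -> word_within T 1 s C.
  elim: l lT => [|s l IH] lT; first by exists 1%R.
  have [|C C1 HC] := IH; first by move=> t /= tl; apply: lT; rewrite /= inE tl orbT.
  have [a sa] := lT s (mem_head _ _).
  exists (Num.max C a); first by rewrite le_max C1.
  move=> t; rewrite inE => /orP[/eqP ->|/HC].
    by apply: word_within_le sa; rewrite le_max lexx orbT.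
  by apply: word_within_le; rewrite le_max lexx.
exists C => // x y a /(@word_within_ind _ (fun x y a => word_within T x y (C * a)%R)).
case=> [z|z s t b ls zt|b ba].
- by rewrite mulr0; exact: word_within_refl.
- rewrite mulrDr mulr1; apply: word_within_trans zt.
  case: ls => /= /HC; first by move=> /(word_within_translate z); rewrite mulg1.
  by move=> /(word_within_translate (z * s)); rewrite mulg1 mulgK => /word_within_sym.
- by apply: word_within_le; rewrite ler_wpM2l // (le_trans ler01).
Qed.

End Words.

Section WordMetric.
Context {R : realType} {G : groupType} {X : Type}.
Variables (A S : set G) (f : X -> G).
Hypothesis (subA : subgroup A) (genS : generates S A) (fA : forall x, A (f x)).
Let d x y := word_dist R S (f x) (f y).

(** The map [f] treats two cases at once: G itself, with the identity, and [H i], with the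
    inclusion. *)
Lemma word_metricP x y a :
  word_dist R S (f x) (f y) <= a <-> word_within S (f x) (f y) a.
Proof.
apply: word_distP; apply: (word_within_connected subA genS); exact: fA.
Qed.

Lemma word_metric_ge0 x y : 0 <= d x y.
Proof.
have /word_metricP[w [_ _]] := lexx (d x y); exact: le_trans.
Qed.

Lemma word_metricxx x : d x x = 0.
Proof.
apply/le_anti; rewrite word_metric_ge0 andbT; apply/word_metricP.
exact: word_within_refl.
Qed.

Lemma word_metricC x y : d x y = d y x.
Proof.
by apply/le_anti/andP; split; apply/word_metricP/word_within_sym/word_metricP.
Qed.

Lemma word_metric_triangle x y z : d x z <= d x y + d y z.
Proof.
by apply/word_metricP; apply: (word_within_trans (y := f y)); apply/word_metricP.
Qed.

End WordMetric.

(** * The graph underlying the Bowditch space *)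

Section BowditchGraph.
Context {R : realType} {G : groupType} {n : nat}.
Variables (H : 'I_n -> set G) (S : set G).
Hypothesis (subH : forall i, subgroup (H i)) (genS : generates S setT).
Notation vtx := (bowditch_vertex (G := G) (n := n)).
Notation E := (bowditch_edge (R := R) H S).
Notation path_within := (@path_within R vtx E).

Definition level (v : vtx) : nat := if v is Deep _ _ k then k.+1 else 0.
Definition foot (v : vtx) : G := match v with Base g => g | Deep _ g _ => g end.

Inductive edge_shape : vtx -> vtx -> R -> Prop :=
| EdgeBase g s : S s -> s <> 1%g -> edge_shape (Base g) (Base (g * s)%g) 1
| EdgeGlue i g : edge_shape (Base g) (Deep i g 0) 1
| EdgeVertical i g k : edge_shape (Deep i g k) (Deep i g k.+1) 1
| EdgeHorizontal i g s k : S s -> H i s -> s <> 1%g ->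
    edge_shape (Deep i g k) (Deep i (g * s)%g k) (expR (- k.+1%:R)).

Lemma bowditch_edgeP u v l : E u v l -> edge_shape u v l.
Proof.
case=> [g h [s [Ss s1 ->]]|i g p q {}l]; first exact: EdgeBase.
case=> [h [|k]|h h' [|k] [s [[Ss Hs] s1 e]]]; rewrite /Defs.glue /= ?e ?mulgA.
- exact: EdgeGlue.
- exact: EdgeVertical.
- by rewrite oppr0 expR0; exact: EdgeBase.
- exact: EdgeHorizontal.
Qed.

(** The levels tell horizontal edges from vertical ones. The formula is symmetric in the two ends,
    which yields [bowditch_edge_uniq]. *)
Lemma edge_shape_length u v l : edge_shape u v l ->
  l = match u, v with
      | Deep _ _ k, Deep _ _ k' => if k == k' then expR (- k.+1%:R) else 1
      | _, _ => 1 end.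
Proof. by case=> //= *; rewrite ?eqxx // ltn_eqF. Qed.

Lemma bowditch_loopless u v l : E u v l -> u <> v.
Proof.
have mulg_neq (g s : G) : s <> 1%g -> g = (g * s)%g -> False.
  by move=> s1 /(congr1 (fun z => g^-1 * z)%g); rewrite mulVg mulKg => /esym.
move=> /bowditch_edgeP[g s _ s1 [/mulg_neq]|//|i g k [] e|i g s k _ _ s1 []].
- exact.
- by have := n_Sn k; rewrite -e.
- by move=> /mulg_neq; exact.
Qed.

Lemma bowditch_edge_length u v l : E u v l -> 0 <= l <= 1.
Proof.
move=> /bowditch_edgeP[] *; rewrite ?ler01 ?lexx //.
by rewrite expR_ge0 -[leRHS]expR0 ler_expR oppr_le0 ler0n.
Qed.

Lemma bowditch_edge_uniq u v l l' :
  E u v l \/ E v u l -> E u v l' \/ E v u l' -> l = l'.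
Proof.
have sym a b : E a b l' \/ E b a l' -> l' = match a, b with
      | Deep _ _ k, Deep _ _ k' => if k == k' then expR (- k.+1%:R) else 1
      | _, _ => 1 end.
  move=> [] /bowditch_edgeP/edge_shape_length -> //.
  by case: a b => [?|? ? k] [?|? ? k'] //; case: eqVneq => // ->.
move=> [] /bowditch_edgeP/edge_shape_length -> e.
  by rewrite (sym u v).
by rewrite (sym v u) //; tauto.
Qed.

Lemma E_vertical i g k : E (Deep i g k) (Deep i g k.+1) 1.
Proof.
have := @bowditch_horoball R _ _ H S i g _ _ _ (horoball_vertical (R := R)
  (fun h h' : H i => cayley (S `&` H i) (val h) (val h'))
  (exist _ 1%g (mem_set (subgroup1 (subH i)))) k.+1).
by rewrite /Defs.glue /= mulg1.
Qed.

Lemma E_glue i g : E (Base g) (Deep i g 0) 1.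
Proof.
have := @bowditch_horoball R _ _ H S i g _ _ _ (horoball_vertical (R := R)
  (fun h h' : H i => cayley (S `&` H i) (val h) (val h'))
  (exist _ 1%g (mem_set (subgroup1 (subH i)))) 0).
by rewrite /Defs.glue /= mulg1.
Qed.

Lemma E_horizontal i g s k : S s -> H i s -> s <> 1%g ->
  E (Deep i g k) (Deep i (g * s)%g k) (expR (- k.+1%:R)).
Proof.
move=> Ss Hs s1.
have := @bowditch_horoball R _ _ H S i g _ _ _
  (@horoball_horizontal R _
  (fun h h' : H i => cayley (S `&` H i) (val h) (val h'))
  (exist _ 1%g (mem_set (subgroup1 (subH i)))) (exist _ s (mem_set Hs)) k.+1 _).
rewrite /Defs.glue /= mulg1; apply.
by exists s; rewrite mul1g.
Qed.

Lemma E_cayley g s : S s -> s <> 1%g -> E (Base g) (Base (g * s)%g) 1.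
Proof. by move=> Ss s1; apply: bowditch_cayley; exists s. Qed.

Lemma path_within_cayley x y a :
  word_within S x y a -> path_within a (Base x) (Base y).
Proof.
move=> /(@word_within_ind _ _ S (fun x y a => path_within a (Base x) (Base y))).
case=> [{}x|{}x s {}y {}a Ss sy|b ba /(path_within_le ba)//].
   exact: path_within_refl.
apply: path_within_trans sy; have [->|/eqP s1] := eqVneq s 1%g.
  by rewrite mulg1; exact: path_within_refl.
case: Ss => Ss; first exact: path_within_edge (E_cayley _ Ss s1) _.
apply: path_within_sym; rewrite -{2}[x](mulgK s).
apply: path_within_edge (E_cayley _ Ss _) _ => //.
by move=> /(congr1 (fun z => z^-1)%g); rewrite invgK invg1.
Qed.

Lemma path_within_horizontal i x y k a : word_within (S `&` H i) x y a ->
  path_within (a * expR (- k.+1%:R)) (Deep i x k) (Deep i y k).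
Proof.
move=> /(@word_within_ind _ _ _ (fun x y a =>
  path_within (a * expR (- k.+1%:R)) (Deep i x k) (Deep i y k))).
case=> [{}x|{}x s {}y {}a Ss sy|b ba]; first 2 last.
- by apply: path_within_le; rewrite ler_wpM2r ?expR_ge0.
- by rewrite mul0r; exact: path_within_refl.
rewrite mulrDl mul1r; apply: path_within_trans sy; have [->|/eqP s1] := eqVneq s 1%g.
  by rewrite mulg1; apply: path_within_refl; exact: expR_ge0.
case: Ss => -[Ss Hs]; first exact: path_within_edge (E_horizontal _ _ Ss Hs s1) _.
apply: path_within_sym; rewrite -{2}[x](mulgK s).
apply: path_within_edge (E_horizontal _ _ Ss Hs _) _ => //.
by move=> /(congr1 (fun z => z^-1)%g); rewrite invgK invg1.
Qed.

Lemma path_within_vertical i x k j :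
  path_within j%:R (Deep i x k) (Deep i x (k + j)).
Proof.
elim: j => [|j IH]; first by rewrite addn0; exact: path_within_refl.
rewrite addnS -natr1; apply: path_within_trans IH _.
exact: path_within_edge (E_vertical _ _ _) _.
Qed.

Lemma path_within_foot v : path_within (level v)%:R (Base (foot v)) v.
Proof.
case: v => [g|i g k]; first exact: path_within_refl.
rewrite /= -natr1 addrC; apply: path_within_trans (path_within_vertical i g 0 k).
exact: path_within_edge (E_glue _ _) _.
Qed.

(** Climb to a common height, cross there at cost at most 1, and come down. *)
Lemma path_within_deep i x y k l K h (a : R) :
  (k <= K <= k + h)%N -> (l <= K <= l + h)%N ->
  word_within (S `&` H i) x y a -> a <= expR K%:R ->
  path_within (h%:R + 1 + h%:R) (Deep i x k) (Deep i y l).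
Proof.
move=> /andP[kK Kk] /andP[lK Kl] xy aK; apply: path_within_trans (path_within_trans _ _) _.
- by apply: path_within_le (path_within_vertical i x k (K - k)); rewrite ler_nat leq_subLR.
- rewrite subnKC //; apply: path_within_le (path_within_horizontal K xy).
  rewrite expRN ler_pdivrMr ?expR_gt0 // mul1r (le_trans aK) //.
  by rewrite ler_expR ler_nat.
- apply: path_within_sym; rewrite -(subnKC lK).
  by apply: path_within_le (path_within_vertical i y l (K - l)); rewrite ler_nat leq_subLR.
Qed.

Lemma bowditch_connected u v : exists a, edge_path E u v a.
Proof.
have [a uv] : exists a, word_within S (foot u) (foot v) (a : R).
  by apply: (word_within_connected _ genS) => //; split=> // *; exact: in_setT.
have := path_within_trans (path_within_sym (path_within_foot u))
  (path_within_trans (path_within_cayley uv) (path_within_foot v)).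
by move=> [b]; exists b.
Qed.

Lemma edge_path_shape_ind a u v (P : vtx -> vtx -> R -> Prop) :
  (forall u, P u u 0) ->
  (forall u v w l a, edge_shape u v l \/ edge_shape v u l -> 0 <= l <= 1 ->
    0 <= a -> P v w a -> P u w (l + a)) ->
  edge_path E u v a -> P u v a.
Proof.
move=> P0 PS; elim=> // {}u {}v w l {}a uv vw; apply: PS.
- by case: uv => /bowditch_edgeP; [left|right].
- by case: uv => /bowditch_edge_length.
- exact (edge_path_ge0 (@bowditch_edge_length) vw).
Qed.

Lemma level_lipschitz u v a : path_within a u v -> (level v)%:R <= (level u)%:R + a.
Proof.
move=> [b uv ba]; suff : (level v)%:R <= (level u)%:R + b.
  by move=> /le_trans; apply; rewrite lerD2l.
elim/edge_path_shape_ind: uv => {u v b ba a} [u|u v w l a uv /andP[l0 _] a0 le].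
  by rewrite addr0.
apply: le_trans le _; rewrite addrA lerD2r.
case: uv => -[] *; rewrite /= ?lerDl ?expR_ge0 -?natr1 //; lra.
Qed.

Lemma expR_step (t t' l b : R) : 0 <= l -> 0 <= b -> t' <= t + l ->
  b * expR (t' + b) <= (l + b) * expR (t + (l + b)).
Proof.
move=> l0 b0 tt; apply: ler_pM => //; rewrite ?expR_ge0 //; first lra.
by rewrite ler_expR; lra.
Qed.

(** A horizontal edge at level t has length exp(-t) and moves the foot by one letter; the product
    exp(-t) exp(t + ...) pays for that letter. *)
Lemma expR_horizontal_step (t b : R) : 0 <= b ->
  1 + b * expR (t + b) <= (expR (- t) + b) * expR (t + (expR (- t) + b)).
Proof.
move=> b0; rewrite [leRHS]mulrDl; have l0 := expR_ge0 (- t); apply: lerD.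
  rewrite -expRD -[leLHS]expR0 ler_expR.
  by lra.
by rewrite ler_wpM2l // ler_expR; lra.
Qed.

(* Along a path of length b from level t the levels stay below t + b, where an
   edge of length l moves the foot by at most l exp(t + b). *)
Lemma word_within_foot u v b : edge_path E u v b ->
  word_within S (foot u) (foot v) (b * expR ((level u)%:R + b)).
Proof.
elim/edge_path_shape_ind => {u v b} [u|u v w l b uv /andP[l0 _] b0 vw].
  by rewrite mul0r; exact: word_within_refl.
(* An edge either keeps the foot and raises the level by at most its length, or keeps the level t,
   has length exp(-t) and moves the foot by one letter. Cayley edges are of the second kind, with t
   = 0. *)
have stay : foot u = foot v -> (level v)%:R <= (level u)%:R + l ->
    word_within S (foot u) (foot w) ((l + b) * expR ((level u)%:R + (l + b))).
  by move=> -> vu; apply: word_within_le vw; exact: expR_step.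
have move_ : word_within S (foot u) (foot v) (1 : R) -> level v = level u ->
    l = expR (- (level u)%:R) ->
    word_within S (foot u) (foot w) ((l + b) * expR ((level u)%:R + (l + b))).
  move=> uv1 vu le; rewrite le; apply: word_within_le (expR_horizontal_step _ b0) _.
  by rewrite -vu; apply: word_within_trans uv1 vw.
move: stay move_; case: uv => -[] /=.
- move=> g s Ss _ _; apply => //; first exact: word_within_letter.
  by rewrite oppr0 expR0.
- by move=> i g + _; apply=> //; rewrite add0r.
- by move=> i g k + _; apply=> //; rewrite -[k.+2%:R]natr1.
- by move=> i g s k Ss _ _ _; apply=> //; exact: word_within_letter.
- move=> g s Ss _ _; apply=> //; last by rewrite oppr0 expR0.
  by apply: word_within_sym; exact: word_within_letter.
- by move=> i g + _; apply=> //; lra.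
- by move=> i g k + _; apply=> //; rewrite -[k.+2%:R]natr1; lra.
- move=> i g s k Ss _ _ _; apply=> //.
  by apply: word_within_sym; exact: word_within_letter.
Qed.

(** A path shorter than the height of its start never reaches the base, so all its horizontal edges
    carry letters of [H i]. *)
Lemma horoball_path i x k v b : edge_path E (Deep i x k) v b -> b < k.+1%:R ->
  exists y l, v = Deep i y l /\
    word_within (S `&` H i) x y (b * expR (k.+1%:R + b)).
Proof.
suff path u : edge_path E u v b -> forall x k, u = Deep i x k -> b < k.+1%:R ->
    exists y l, v = Deep i y l /\
      word_within (S `&` H i) x y (b * expR (k.+1%:R + b)).
  by move=> /path; apply.
elim/edge_path_shape_ind => {u v b x k} [u x k -> _|
  u v w l b uv /andP[l0 l1] b0 IH x k ue lb].
  by exists x, k; rewrite mul0r; split=> //; exact: word_within_refl.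
have stay j : v = Deep i x j -> b < j.+1%:R -> j.+1%:R <= k.+1%:R + l ->
    exists y m, w = Deep i y m /\
      word_within (S `&` H i) x y ((l + b) * expR (k.+1%:R + (l + b))).
  move=> vE bj jk; have [y [m [-> xy]]] := IH _ _ vE bj.
  by exists y, m; split=> //; apply: word_within_le xy; exact: expR_step.
have move_ z : v = Deep i z k -> word_within (S `&` H i) x z (1 : R) ->
    l = expR (- k.+1%:R) ->
    exists y m, w = Deep i y m /\
      word_within (S `&` H i) x y ((l + b) * expR (k.+1%:R + (l + b))).
  move=> vE xz le; have [|y [m [-> zy]]] := IH _ _ vE; first lra.
  exists y, m; split=> //; rewrite le.
  apply: word_within_le (expR_horizontal_step _ b0) _.
  by apply: word_within_trans xz zy.
(* After a vertical edge the remaining length is below k, so the path stays in the horoball even if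
   that edge goes down. *)
have bk : l = 1 -> b < k%:R by move: lb; rewrite -natr1; lra.
move: ue bk stay move_; case: uv => -[] //.
- move=> j g m [-> -> ->] bk + _; apply => //.
    by rewrite -natr1; have := bk erefl; lra.
  by rewrite -natr1.
- move=> j g s m Ss Hs _ [<- <- <-] _ _; apply => //.
  exact: word_within_letter.
- by move=> j g [_ _ <-] /(_ erefl); rewrite ltNge b0.
- move=> j g m [-> -> <-] bk + _; apply => //; first exact: bk.
  by rewrite -[m.+2%:R]natr1; lra.
- move=> j g s m Ss Hs _ [<- <- <-] _ _; apply => //.
  by apply: word_within_sym; exact: word_within_letter.
Qed.

End BowditchGraph.

(** * Comparison with the word metrics *)

Section Comparison.
Context {R : realType} {G : groupType} {n : nat}.
Variables (H : 'I_n -> set G) (S T : set G) (TH : 'I_n -> set G).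
Hypothesis subH : forall i, subgroup (H i).
Hypothesis (finS : finite_set S) (genS : generates S setT).
Hypothesis genSH : forall i, generates (S `&` H i) (H i).
Hypothesis (finT : finite_set T) (genT : generates T setT).
Hypothesis finTH : forall i, finite_set (TH i).
Hypothesis genTH : forall i, generates (TH i) (H i).
Notation vtx := (bowditch_vertex (G := G) (n := n)).
Notation E := (bowditch_edge (R := R) H S).
Notation path_within := (@path_within R vtx E).
Notation dX := (bowditch_dist R H S).
Notation dH i := (fun h h' : H i => word_dist R (TH i) (val h) (val h')).

Let sub_setT : @subgroup G setT.
Proof. by split=> // *; exact: in_setT. Qed.

Lemma word_within_generators (A S1 S2 : set G) : finite_set S1 ->
  generates S1 A -> generates S2 A ->
  exists2 C : R, 1 <= C & forall x y a,
    word_within S1 x y a -> word_within S2 x y (C * a).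
Proof.
move=> fin1 gen1 gen2; apply: word_within_change => // s S1s.
by apply: (generates_word gen2); apply: generates_sub gen1 _ S1s.
Qed.

Lemma finite_SH i : finite_set (S `&` H i).
Proof. exact: finite_setIl. Qed.

Lemma path_within_of_bowditch_dist u v D :
  dX (vertex E u) (vertex E v) <= D -> path_within (D + 1) u v.
Proof.
apply: path_within_of_dist.
- exact: bowditch_loopless.
- exact: bowditch_edge_length.
- exact: bowditch_edge_uniq.
- exact: bowditch_connected.
Qed.

Lemma bowditch_dist_of_path_within u v D :
  path_within D u v -> dX (vertex E u) (vertex E v) <= D.
Proof. apply: path_dist_of_within; exact: bowditch_edge_length. Qed.

Lemma expR_mono (b c t : R) : 0 <= b -> b <= c ->
  b * expR (t + b) <= c * expR (t + c).
Proof.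
by move=> b0 bc; rewrite ler_pM ?expR_ge0 // ler_expR lerD2l.
Qed.

Lemma path_within_foot_word u v D : path_within D u v ->
  word_within S (foot u) (foot v) (D * expR ((level u)%:R + D)).
Proof.
move=> [b uv bD]; apply: word_within_le (word_within_foot uv).
exact: expR_mono (edge_path_ge0 (@bowditch_edge_length _ _ _ _ _) uv) bD.
Qed.

Lemma path_within_horoball i x k v D :
  path_within D (Deep i x k) v -> D < k.+1%:R ->
  exists y l, v = Deep i y l /\
    word_within (S `&` H i) x y (D * expR (k.+1%:R + D)).
Proof.
move=> [b xv bD] Dk; have [y [l [-> xy]]] := horoball_path xv (le_lt_trans bD Dk).
exists y, l; split=> //; apply: word_within_le xy.
exact: expR_mono (edge_path_ge0 (@bowditch_edge_length _ _ _ _ _) xv) bD.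
Qed.

Lemma colorable_group (k : nat) (r : R) : 0 < r ->
  (forall r : R, 0 < r -> exists D : R, has_cover (word_dist R T) r D k) ->
  exists D : R, colorable k.+1 (fun x y => word_within S x y r)
    (fun x y => word_within S x y D).
Proof.
move=> r0 cov.
have [C1 C1_ge ST] := word_within_generators finS genS genT.
have [C2 C2_ge TS] := word_within_generators finT genT genS.
have C1r : 0 < C1 * r by rewrite mulr_gt0 // (lt_le_trans ltr01).
have [|D HD] := cov (2 * (k.+1%:R * (C1 * r))); first by do 2?apply: mulr_gt0.
have wdP x y a : word_dist R T x y <= a <-> word_within T x y a.
  exact: (word_metricP (f := id) sub_setT genT).
eexists; apply: colorable_sub (colorable_of_has_cover _ _ _ (ltW C1r) HD) => //.
- by move=> x y /ST/wdP.
- by move=> x y /wdP/TS; apply.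
- exact: (word_metricxx (f := id) sub_setT genT).
- exact: (word_metricC (f := id) sub_setT genT).
- exact: (word_metric_triangle (f := id) sub_setT genT).
Qed.

(* The covers of H i are transported to each coset x (H i) by a representative
   of the coset. *)
Lemma colorable_cosets (m : nat) i :
  (exists L r0 : R, forall r, r0 < r -> has_cover (dH i) r (L * r) m) ->
  exists a : R, forall b r : R, a <= b -> b <= r ->
    colorable m.+1 (fun x y => word_within (S `&` H i) x y r)
      (fun x y => word_within (S `&` H i) x y (b * r)).
Proof.
move=> [L [r0 cov]].
have [C1 C1_ge ST] := word_within_generators (finite_SH i) (genSH i) (genTH i).
have [C2 C2_ge TS] := word_within_generators (finTH i) (genTH i) (genSH i).
pose M : R := 2 * m.+1%:R.
have M1 : 1 <= M by rewrite /M -natrM ler1n.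
(* The first bound makes r positive and larger than [r0]. The second is the linear constant:
   colouring at scale C1 r uses a cover by pieces of diameter L M C1 r and adds M C1 r; [C2] changes
   generators back. *)
exists (Num.max (`|r0| + 1) (C2 * (`|L| * (M * C1) + M * C1))) => b r.
rewrite ge_max => /andP[br0 ba] rb.
have r_gt0 : 0 < r by have := normr_ge0 r0; move: br0 rb; lra.
have C1r : r <= C1 * r by rewrite ler_peMl // ltW.
have C1r0 : 0 <= C1 * r by rewrite (le_trans _ C1r) // ltW.
have HD : has_cover (dH i) (M * (C1 * r)) (L * (M * (C1 * r))) m.
  apply: cov; apply: (@lt_le_trans _ _ r).
    by have := ler_norm r0; move: br0 rb; lra.
  by rewrite (le_trans C1r) // ler_peMl // (le_trans _ C1r) // ltW.
have [c [p [ck cN cB]]] : colorable m.+1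
    (fun h h' : H i => word_within (S `&` H i) (val h) (val h') r)
    (fun h h' : H i => word_within (S `&` H i) (val h) (val h') (b * r)).
  have wdP (h h' : H i) a : word_dist R (TH i) (val h) (val h') <= a <->
      word_within (TH i) (val h) (val h') a.
    exact: (word_metricP (f := fun h : H i => val h) (subH i) (genTH i)
      (fun h => set_mem (valP h))).
  rewrite /M -mulrA in HD.
  apply: colorable_sub (colorable_of_has_cover _ _ _ _ HD) => // [h h'|h h'|||].
  - by move=> /ST/wdP.
  - move=> /wdP/TS; apply: word_within_le.
    rewrite [2 * (_ * _)]mulrA -/M.
    apply: (@le_trans _ _ (C2 * (`|L| * (M * C1) + M * C1) * r)); last first.
      by rewrite ler_wpM2r // ltW.
    rewrite -[leRHS]mulrA ler_wpM2l ?(le_trans ler01) // [leRHS]mulrDl -!mulrA.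
    rewrite lerD2r ler_wpM2r ?ler_norm // mulr_ge0 //.
    by rewrite mulr_ge0.
  - exact: (word_metricxx (f := fun h : H i => val h) (subH i) (genTH i)
      (fun h => set_mem (valP h))).
  - exact: (word_metricC (f := fun h : H i => val h) (subH i) (genTH i)
      (fun h => set_mem (valP h))).
  - exact: (word_metric_triangle (f := fun h : H i => val h) (subH i) (genTH i)
      (fun h => set_mem (valP h))).
pose rep x := xget 1%g [set y | H i (x^-1 * y)%g].
have repH x : H i (x^-1 * rep x)%g.
  rewrite /rep; case: xgetP => [y ->//|/(_ x)]; case.
  by rewrite /= mulVg; exact: subgroup1.
have rep_eq x y : H i (x^-1 * y)%g -> rep x = rep y.
  move=> xy; rewrite /rep; congr xget; apply/seteqP; split=> z /=.
    move=> xz; have := subgroupM (subH i) (subgroupV (subH i) xy) xz.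
    by rewrite invgM invgK -mulgA mulVKg.
  move=> yz; have := subgroupM (subH i) xy yz.
  by rewrite -mulgA mulVKg.
have hP x : ((rep x)^-1 * x)%g \in H i.
  apply: mem_set; have := subgroupV (subH i) (repH x).
  by rewrite invgM invgK.
pose h x : H i := exist (fun z => z \in H i) _ (hP x).
have repK x : (rep x * val (h x))%g = x by rewrite mulVKg.
(* Words over [H i] never leave a coset, so putting the representative in the label separates cosets
   without separating neighbours. *)
apply: (colorable_any (c := c \o h) (p := fun x => (rep x, p (h x)))).
- by move=> x; exact: ck.
- move=> x y xy cxy; have rxy : rep x = rep y.
    by apply: rep_eq; apply: word_within_subgroup xy => // z [].
  congr pair => //; apply: cN => //.
  by have := word_within_translate (rep x)^-1 xy; rewrite {2}rxy.
- move=> x y cxy [rxy pxy]; rewrite -(repK x) -(repK y) -rxy.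
  by apply: word_within_translate; exact: cB.
Qed.

Lemma asdim_group_le : (asdim (word_dist R T) <= asdim dX)%E.
Proof.
have [->|[k -> cov]] := asdimP dX; first exact: leey.
apply: ereal_inf_lbound; exists k => // r r0.
have [C1 C1_ge TS] := word_within_generators finT genT genS.
have [C2 C2_ge ST] := word_within_generators finS genS genT.
have [|D HD] := cov (C1 * r); first by rewrite mulr_gt0 // (lt_le_trans ltr01).
exists (C2 * ((D + 1) * expR (0%:R + (D + 1)))).
suff [U HU] : has_cover (word_dist R T) r (C2 * ((D + 1) * expR (0%:R + (D + 1)))) k.
  by exists U.
have wdP x y a : word_dist R T x y <= a <-> word_within T x y a.
  exact: (word_metricP (f := id) sub_setT genT).
apply: (has_cover_pullback (f := fun g => vertex E (Base g))) HD => x y.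
  move=> /wdP/TS xy; apply: bowditch_dist_of_path_within.
  exact: path_within_cayley.
move=> /path_within_of_bowditch_dist/path_within_foot_word /=/ST xy.
by apply/wdP.
Qed.

(** One cover of X(G), at scale 1, serves every scale r of [H i]: it is restricted to the height
    near ln(C1 r), where words of length C1 r span paths of length at most 1. *)
Lemma lasdim_subgroup_le i : (lasdim (dH i) <= asdim dX)%E.
Proof.
have [->|[k -> cov]] := asdimP dX; first exact: leey.
apply: ereal_inf_lbound; exists k => //.
have [C1 C1_ge TS] := word_within_generators (finTH i) (genTH i) (genSH i).
have [C2 C2_ge ST] := word_within_generators (finite_SH i) (genSH i) (genTH i).
have [D HD] := cov 1 ltr01.
have C1_gt0 : 0 < C1 by apply: lt_le_trans ltr01 _.
(* A path of length D + 1 from level t + 1 gives a word of length (D + 1) exp(t + 1 + D + 1), and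
   exp t <= C1 r. *)
pose L := C2 * ((D + 1) * expR (D + 1) * (expR 1 * C1)).
(* The threshold exp(D + 1) puts level t + 1 above D + 1, so that these paths stay in the
   horoball. *)
exists L, (Num.max 1 (expR (D + 1))); split; first exact: num_real.
move=> r; rewrite gt_max => /andP[r1 rD].
suff [U HU] : has_cover (dH i) r (L * r) k by exists U.
have r0 : 0 < r := lt_trans ltr01 r1.
have Cr_ge : r <= C1 * r by rewrite ler_peMl // ltW.
have Cr_gt0 : 0 < C1 * r by rewrite mulr_gt0.
pose t := Num.truncn (ln (C1 * r)).
have /andP[t_le t_gt] : t%:R <= ln (C1 * r) < t.+1%:R.
  by apply: truncn_itv; rewrite ln_ge0 // (le_trans (ltW r1)).
have wdP (h h' : H i) a : word_dist R (TH i) (val h) (val h') <= a <->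
    word_within (TH i) (val h) (val h') a.
  exact: (word_metricP (f := fun h : H i => val h) (subH i) (genTH i)
    (fun h => set_mem (valP h))).
apply: (has_cover_pullback (f := fun h : H i => vertex E (Deep i (val h) t))) HD => h h'.
- move=> /wdP/TS hh; apply: bowditch_dist_of_path_within.
  apply: path_within_le (path_within_horizontal subH t hh).
  rewrite expRN ler_pdivrMr ?expR_gt0 // mul1r -ler_ln ?posrE ?expR_gt0 //.
  by rewrite expRK ltW.
- move=> /path_within_of_bowditch_dist nhh.
  have D0 := path_within_ge0 (@bowditch_edge_length _ _ _ _ _) nhh.
  have := path_within_horoball nhh; case.
    apply: lt_trans t_gt; rewrite -(expRK (D + 1)) ltr_ln ?posrE ?expR_gt0 //.
    exact: lt_le_trans rD Cr_ge.
  move=> y [l [[<- _] hh]]; apply/wdP; apply: word_within_le (ST _ _ _ hh).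
  rewrite /L -mulrA ler_wpM2l ?(le_trans ler01) //.
  rewrite -!mulrA ler_wpM2l // -natr1 -addrA !(expRD t%:R, expRD 1).
  rewrite [leRHS]mulrCA [leRHS]mulrA [leLHS]mulrC ler_wpM2l //.
  by rewrite -ler_ln ?posrE ?expR_gt0 // expRK.
Qed.

End Comparison.

(** * Colourings of horoballs *)

(* Blocks are numbered z q + o, with o < q, where z is the zone and o the
   position in the zone. *)
Section Zones.
Local Open Scope nat_scope.
Variables (q z z' o o' : nat).
Hypotheses (oq : o < q) (oq' : o' < q).
Hypotheses (step : z * q + o <= (z' * q + o').+1)
  (step' : z' * q + o' <= (z * q + o).+1).

Lemma zone_gap (y y' h : nat) : y + h <= y' -> y * q + h * q <= y' * q.
Proof. by rewrite -mulnDl leq_mul2r => ->; rewrite orbT. Qed.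

(** Adjacent blocks in different zones include one at offset 0, which is below every slab. *)
Lemma zone_upper c : c.*2.+1 < o -> c.*2.+1 < o' -> z = z'.
Proof. by have := @zone_gap z z' 1; have := @zone_gap z' z 1; lia. Qed.

(** Adjacent blocks in different zones include one at offset q - 1, which is above the slab. *)
Lemma zone_lower c : c.*2.+4 <= q -> o < c.*2.+1 -> o' < c.*2.+1 -> z = z'.
Proof. by have := @zone_gap z z' 1; have := @zone_gap z' z 1; lia. Qed.

(** Within a zone the slab keeps the two parts non-adjacent; the only passage is from the top of a
    zone to the bottom of the next. *)
Lemma zone_crossing c : c.*2.+1 < o -> o' < c.*2.+1 -> z' = z.+1.
Proof.
have := @zone_gap z z' 2; have := @zone_gap z' z 1.
by have := @zone_gap z z' 0; have := @zone_gap z' z 0; lia.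
Qed.

(** With q even, every slab has an odd block number, so two adjacent ones coincide. *)
Lemma zone_slab c c' :
  ~~ odd q -> o = c.*2.+1 -> o' = c'.*2.+1 -> z = z' /\ c = c'.
Proof.
move=> qeven e e'; have g := @zone_gap z z' 1; have g' := @zone_gap z' z 1.
have := even_halfK qeven; move: (q./2) => r qr.
have zr y : y * q = (y * r).*2 by rewrite -qr -doubleMr.
have zz : z = z' by move: step step' g g'; rewrite !zr; lia.
by split=> //; move: step step'; rewrite zz; lia.
Qed.

End Zones.

Section Horoball.
Context {R : realType} {G : groupType} {n : nat}.
Variables (H : 'I_n -> set G) (S : set G).
Hypothesis subH : forall i, subgroup (H i).
Notation path_within := (@path_within R _ (bowditch_edge (R := R) H S)).

(* At heights around j M the horoball looks like H i at scale exp (j M), and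
   there we use a covering of H i with m+1 colours at this scale. In each zone
   the pieces of colour c are cut at a height that depends on c; the slabs
   between the two parts, which are far apart, get the new colour m+1. The upper
   part of a zone is absorbed by the lower part of the next one, where the scale
   is much larger; as all pieces are cut in each zone, they remain bounded. *)
Lemma horoball_colorable i (m w : nat) (a0 s : R) :
  0 <= s -> s + 1 <= w%:R ->
  (forall b r : R, a0 <= b -> b <= r ->
    colorable m.+1 (fun x y => word_within (S `&` H i) x y r)
      (fun x y => word_within (S `&` H i) x y (b * r))) ->
  exists D : R, colorable m.+2
    (fun u v : G * nat => [/\ (w <= u.2)%N, (w <= v.2)%N &
       path_within s (Deep i u.1 u.2) (Deep i v.1 v.2)])
    (fun u v => path_within D (Deep i u.1 u.2) (Deep i v.1 v.2)).
Proof.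
move=> s0 sw HC; pose a := Num.max a0 0.
have a_ge0 : 0 <= a by rewrite le_max lexx orbT.
have aa0 : a0 <= a by rewrite le_max lexx.
have w_gt0 : (0 < w)%N by rewrite -(ltr_nat R); lra.
pose e := (Num.truncn a).+1; have ae : a < e%:R by exact: truncnS_gt.
(* [q] is even for [zone_slab], at least 2c + 4 for each colour c <= m, and large enough that M >= e
   + 1, whence exp M >= 2 + a. *)
pose q := (m + e).+2.*2; pose M := (w * q)%N.
have q_gt0 : (0 < q)%N by rewrite /q; lia.
have eM : 2 + a <= expR M%:R.
  apply: le_trans (expR_ge1Dx _).
  have : (e.+1)%:R <= M%:R :> R by rewrite ler_nat /M /q; nia.
  by rewrite -natr1; lra.
(* [A] is positive, at least a, so that a <= r j, and at least s exp(M + s), so that a step of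
   length s in zone j is a word of length at most r j. *)
pose A := a + s * expR (M%:R + s) + 1.
have sA : s * expR (M%:R + s) <= A by rewrite /A; lra.
have A_gt0 : 0 < A.
  by rewrite /A; have := mulr_ge0 s0 (expR_ge0 (M%:R + s)); lra.
pose r j := A * expR (j * M)%:R.
have e1 j : 1 <= expR (j * M)%:R :> R by rewrite -expR0 ler_expR.
have ar j : a <= r j.
  apply: (@le_trans _ _ A); last by rewrite /r ler_peMr // ltW.
  by rewrite /A; have := mulr_ge0 s0 (expR_ge0 (M%:R + s)); lra.
pose coloring j (cp : (G -> nat) * (G -> set G)) := [/\ forall x, (cp.1 x < m.+1)%N,
  forall x y, word_within (S `&` H i) x y (r j) ->
    cp.1 x = cp.1 y -> cp.2 x = cp.2 y &
  forall x y, cp.1 x = cp.1 y -> cp.2 x = cp.2 y ->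
    word_within (S `&` H i) x y (a * r j)].
have exc j : exists cp, coloring j cp.
  by have [c [p cpP]] := HC a (r j) aa0 (ar j); exists (c, p).
have [cp cpP] := choice exc.
(* Blocks are [w] levels thick and s < w, so a step of length s changes the block number by at most
   one. *)
pose block (u : G * nat) := (u.2 %/ w)%N.
pose zone u := (block u %/ q)%N; pose off u := (block u %% q)%N.
have blockE u : block u = (zone u * q + off u)%N by exact: divn_eq.
have offq u : (off u < q)%N by rewrite ltn_mod.
pose c0 u := (cp (zone u)).1 u.1; pose p0 u := (cp (zone u)).2 u.1.
have c0m u : (c0 u < m.+1)%N by have [+ _ _] := cpP (zone u); apply.
have cq u : ((c0 u).*2.+4 <= q)%N by have := c0m u; rewrite /q; lia.
pose upper := [set u | ((c0 u).*2.+1 < off u)%N].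
pose slab u := off u == (c0 u).*2.+1.
pose c u := if slab u then m.+1 else c0 u.
(* The label retains [c0], because slabs cut for different old colours share the new colour. *)
pose p u := (zone u, c0 u, p0 u).
have zoneM u : (zone u * M <= u.2 < (zone u).+1 * M)%N.
  have := divn_eq u.2 w; have := ltn_pmod u.2 w_gt0; rewrite -/(block u).
  have := blockE u; have := offq u; rewrite /M; nia.
have samep u v : p u = p v -> zone u = zone v /\
    word_within (S `&` H i) u.1 v.1 (a * r (zone u)).
  rewrite /p => -[zuv cuv puv]; split=> //; have [_ _ cB] := cpP (zone u).
  by apply: cB; [move: cuv|move: puv]; rewrite /c0 /p0 -zuv.
pose N u v := [/\ (w <= u.2)%N, (w <= v.2)%N &
  path_within s (Deep i u.1 u.2) (Deep i v.1 v.2)].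
have Nsym u v : N u v -> N v u.
  by move=> [wu wv uv]; split=> //; exact: path_within_sym uv.
have Nword u v : N u v ->
    word_within (S `&` H i) u.1 v.1 (s * expR ((M%:R + s) + (zone u * M)%:R)).
  move=> [wu _ nuv]; have := path_within_horoball nuv; case.
    by apply: (@lt_le_trans _ _ w%:R); [lra|rewrite ler_nat; lia].
  move=> y [l [[<- _]]]; apply: word_within_le; rewrite ler_wpM2l // ler_expR.
  have : u.2.+1%:R <= M%:R + (zone u * M)%:R :> R.
    by rewrite -natrD ler_nat -mulSn; have /andP[] := zoneM u.
  lra.
have Nblock u v : N u v -> (block v <= (block u).+1)%N.
  move=> [_ _ nuv]; have /= lv := level_lipschitz nuv.
  have {}lv : (v.2 <= u.2 + w)%N.
    by move: lv; rewrite -(ler_nat R) natrD -!natr1; lra.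
  by apply: leq_trans (leq_div2r w lv) _; rewrite divnDr // divnn w_gt0 addn1.
have zone_le u v : N u v -> (zone u * q + off u <= (zone v * q + off v).+1)%N.
  by move=> /Nsym/Nblock; rewrite !blockE.
have zone_ge u v : N u v -> (zone v * q + off v <= (zone u * q + off u).+1)%N.
  by move=> /Nblock; rewrite !blockE.
have c_upper u : upper u -> c u = c0 u.
  by rewrite /upper /= /c /slab; case: ltngtP.
have Nsame u v : N u v -> zone u = zone v -> c0 u = c0 v -> p u = p v.
  move=> Nuv zuv cuv; rewrite /p zuv cuv; congr (_, _); rewrite /p0 zuv.
  have [_ cN _] := cpP (zone v); apply: cN; last by move: cuv; rewrite /c0 zuv.
  apply: word_within_le (Nword _ _ Nuv).
  by rewrite expRD mulrA zuv /r ler_wpM2r ?expR_ge0.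
(* With u and x in one piece of zone z, the points v and v' differ by a word of length at most (2 +
   a) A exp(z M) <= A exp((z + 1) M), the scale of the next zone. *)
have Nnext u v v' x : upper u -> upper x -> ~ upper v -> ~ upper v' ->
    c x = c u -> c v = c u -> c v' = c u -> p u = p x -> N u v -> N x v' ->
    p v = p v'.
  move=> Uu Ux Lv Lv'; rewrite (c_upper _ Uu) (c_upper _ Ux) => cx.
  have lower y : ~ upper y -> c y = c0 u -> c0 y = c0 u /\ (off y < (c0 y).*2.+1)%N.
    rewrite /upper /= /c /slab; have cm := c0m u; case: (ltngtP (off y)) => //.
    by move=> _ _ e'; move: cm; rewrite -e' ltnn.
  move=> /(lower _ Lv)[cv ov] /(lower _ Lv')[cv' ov'] pux Nuv Nxv.
  have [zux ux] := samep _ _ pux.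
  have zv : zone v = (zone u).+1.
    apply: (zone_crossing (offq u) (offq v) (zone_le _ _ Nuv) (zone_ge _ _ Nuv) Uu).
    by rewrite -cv.
  have zv' : zone v' = (zone u).+1.
    rewrite zux.
    apply: (zone_crossing (offq x) (offq v') (zone_le _ _ Nxv) (zone_ge _ _ Nxv) Ux).
    by rewrite cx -cv'.
  rewrite /p /p0 zv zv' cv cv'; congr (_, _).
  have [_ cN _] := cpP (zone u).+1; apply: cN; last first.
    by move: cv cv'; rewrite /c0 zv zv' => -> ->.
  have := word_within_trans (word_within_sym (Nword _ _ Nuv))
    (word_within_trans ux (Nword _ _ Nxv)).
  apply: word_within_le; rewrite -zux !(expRD (M%:R + s)) /r.
  rewrite mulSn natrD (expRD _ (_ * _)%:R) !mulrA -!mulrDl ler_wpM2r ?expR_ge0 //.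
  apply: (@le_trans _ _ (A * (2 + a))); last by rewrite ler_wpM2l // ltW.
  by have : a * A = A * a := mulrC _ _; lra.
(* Since a A <= exp J, a piece of zone z can be crossed at cost 1 at height (z + 1) M + J. The
   resulting bound [D] does not depend on z. *)
pose J := (Num.truncn (ln (1 + a * A))).+1.
have JaA : a * A <= expR J%:R.
  have aA0 : 0 <= a * A by rewrite mulr_ge0 // ltW.
  apply: (@le_trans _ _ (1 + a * A)); first lra.
  rewrite -[leLHS]lnK ?posrE; last lra.
  by rewrite ler_expR ltW // truncnS_gt.
pose D := (M + J)%:R + 1 + (M + J)%:R : R.
have D0 : 0 <= D by rewrite /D !addr_ge0.
have pD u v : p u = p v -> path_within D (Deep i u.1 u.2) (Deep i v.1 v.2).
  move=> /samep[zuv uv].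
  apply: (@path_within_deep _ _ _ _ _ subH _ _ _ _ _ ((zone u).+1 * M + J) _ _ _ _ uv).
  - by have := zoneM u; rewrite !mulSn; lia.
  - by have := zoneM v; rewrite zuv !mulSn; lia.
  - rewrite /r mulrA natrD addrC expRD ler_pM ?expR_ge0 ?mulr_ge0 // ?ltW //.
    by rewrite ltr_expR ltr_nat mulSn; lia.
exists (D + s + (D + s) + D).
apply: (colorable_absorb (A := upper) (c := c) (pA := p) (pB := p)).
- by move=> u; rewrite /c; case: ifP => // _; apply: leqW.
- exact: Nsym.
- move=> u v Uu Uv Nuv; rewrite (c_upper _ Uu) (c_upper _ Uv) => cuv.
  apply: Nsame => //.
  apply: (zone_upper (offq u) (offq v) (zone_le _ _ Nuv) (zone_ge _ _ Nuv) Uu).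
  by rewrite cuv.
- move=> u v Lu Lv Nuv cuv; suff [zuv cc] : zone u = zone v /\ c0 u = c0 v.
    exact: Nsame.
  move: Lu Lv cuv; rewrite /upper /= /c /slab.
  have cu := c0m u; have cv := c0m v.
  case: (ltngtP (off u)) => // ou _; case: (ltngtP (off v)) => // ov _ cc.
  + split=> //.
    apply: (zone_lower (offq u) (offq v) (zone_le _ _ Nuv) (zone_ge _ _ Nuv) (cq u)) => //.
    by rewrite cc.
  + by move: cu; rewrite cc ltnn.
  + by move: cv; rewrite -cc ltnn.
  + apply: (zone_slab (offq u) (offq v) (zone_le _ _ Nuv) (zone_ge _ _ Nuv)) => //.
    by rewrite /q odd_double.
- move=> u x v v' Uu Ux Lv Lv' cx cv cv' pux Nuv Nxv.
  exact: (Nnext u v v' x).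
- move=> u v _ _ _ /pD; apply: path_within_le; lra.
- move=> u v z z' _ _ _ _ _ pzz uz vz.
  have join y t : y = t \/ upper y /\ (exists x',
      [/\ upper x', c x' = c y, p x' = p y & N x' t]) ->
      path_within (D + s) (Deep i y.1 y.2) (Deep i t.1 t.2).
    move=> [->|[_ [x' [_ _ /pD xy [_ _ xt]]]]]; first by apply: path_within_refl; lra.
    exact: path_within_trans (path_within_sym xy) xt.
  have := path_within_trans (path_within_trans (join _ _ uz) (pD _ _ pzz))
    (path_within_sym (join _ _ vz)).
  by apply: path_within_le; lra.
Qed.

End Horoball.

(** * Upper bound *)

Section Bowditch.
Context {R : realType} {G : groupType} {n : nat}.
Variables (H : 'I_n -> set G) (S T : set G) (TH : 'I_n -> set G).
Hypothesis subH : forall i, subgroup (H i).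
Hypothesis (finS : finite_set S) (genS : generates S setT).
Hypothesis genSH : forall i, generates (S `&` H i) (H i).
Hypothesis (finT : finite_set T) (genT : generates T setT).
Hypothesis finTH : forall i, finite_set (TH i).
Hypothesis genTH : forall i, generates (TH i) (H i).
Notation vtx := (bowditch_vertex (G := G) (n := n)).
Notation path_within := (@path_within R vtx (bowditch_edge (R := R) H S)).
Notation dX := (bowditch_dist R H S).
Notation dH i := (fun h h' : H i => word_dist R (TH i) (val h) (val h')).

Lemma bowditch_colorable (N : nat) (s : R) : 0 < s ->
  (forall r : R, 0 < r -> exists D : R, has_cover (word_dist R T) r D N) ->
  (forall i, exists2 m, (m < N)%N & exists L r0 : R,
     forall r, r0 < r -> has_cover (dH i) r (L * r) m) ->
  exists D, colorable N.+1 (path_within s) (path_within D).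
Proof.
move=> s0 covG covH; pose w := (Num.truncn (s + 1)).+1.
have sw : s + 1 <= w%:R by rewrite ltW // truncnS_gt.
have sw' : s < w%:R by lra.
pose deep i (u : G * nat) : vtx := Deep i u.1 u.2.
have exH i : exists D : R, colorable N.+1
    (fun u v => [/\ (w <= u.2)%N, (w <= v.2)%N &
      path_within s (deep i u) (deep i v)])
    (fun u v => path_within D (deep i u) (deep i v)).
  have [m mN [L [r0 cov]]] := covH i.
  have [a aP] := colorable_cosets subH finS genSH finTH genTH
    (ex_intro _ L (ex_intro _ r0 cov)).
  have [D HD] := horoball_colorable subH (ltW s0) sw aP.
  by exists D; apply: colorable_sub HD.
have [D_ HD_] := choice exH; pose D : R := \sum_i `|D_ i|.
have D_le i : D_ i <= D.
  apply: le_trans (ler_norm _) _; rewrite /D (bigD1 i) //= lerDl.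
  by apply: sumr_ge0.
have D0 : 0 <= D by apply: sumr_ge0.
have exc i : exists cp : (G * nat -> nat) * (G * nat -> set (G * nat)),
    [/\ forall u, (cp.1 u < N.+1)%N,
    forall u v, (w <= u.2)%N -> (w <= v.2)%N ->
      path_within s (deep i u) (deep i v) ->
      cp.1 u = cp.1 v -> cp.2 u = cp.2 v &
    forall u v, cp.1 u = cp.1 v -> cp.2 u = cp.2 v ->
      path_within D (deep i u) (deep i v)].
  have [c [p [ck cN cB]]] := HD_ i; exists (c, p); split=> //= u v.
    by move=> wu wv uv; apply: cN.
  by move=> cuv puv; apply: path_within_le (D_le i) (cB _ _ cuv puv).
have [cp cpP] := choice exc.
(* Two shallow vertices near the same deep piece are within s + D + s of each other; G is coloured
   at the scale this distance gives at levels up to w, so that they share a piece. *)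
pose s2 := s + (D + s).
have s2_gt0 : 0 < s2 by rewrite /s2; lra.
have [|DG [cG [pG [cGk cGN cGB]]]] :=
    @colorable_group R G S T finS genS finT genT N (s2 * expR (w%:R + s2)) _ covG.
  by rewrite mulr_gt0 ?expR_gt0.
pose isdeep (v : vtx) := exists i u, v = deep i u /\ (w <= u.2)%N.
have notdeep v : ~ isdeep v -> (level v <= w)%N.
  case: v => //= i g k nd; rewrite ltnNge; apply/negP => wk; apply: nd.
  by exists i, (g, k).
pose c (v : vtx) := if v is Deep i g k then
  if (w <= k)%N then (cp i).1 (g, k) else cG g else cG (foot v).
(* The sum type gives [pA] and [pB] a common type; [set0] is a dummy, [pA] being compared on deep
   vertices only. *)
pose pA (v : vtx) : _ + set G := if v is Deep i g k then
  inl (i, (cp i).2 (g, k)) else inr set0.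
pose pB (v : vtx) : ('I_n * set (G * nat)) + set G := inr (pG (foot v)).
have c_deep i u : (w <= u.2)%N -> c (deep i u) = (cp i).1 u.
  by case: u => g k /= ->.
have c_base v : ~ isdeep v -> c v = cG (foot v).
  by move=> /notdeep; case: v => //= i g k; rewrite ltnNge => /negbTE ->.
have sameA x y : isdeep x -> isdeep y -> c x = c y -> pA x = pA y -> path_within D x y.
  move=> [i [u [-> wu]]] [j [v [-> wv]]]; rewrite !c_deep //.
  case: u v wu wv => [g k] [h l] wu wv cuv /= -[ij]; subst j => puv.
  by have [_ _] := cpP i; apply.
have sameB x y a : a <= s2 -> ~ isdeep x -> ~ isdeep y -> path_within a x y ->
    c x = c y -> pB x = pB y.
  move=> a2 Bx By xy; rewrite !c_base // => cxy; congr inr; apply: cGN => //.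
  have a0 := path_within_ge0 (@bowditch_edge_length _ _ _ _ _) xy.
  apply: word_within_le (path_within_foot_word xy).
  rewrite ler_pM ?expR_ge0 // ler_expR lerD // ler_nat.
  exact: notdeep.
have boundB x y : ~ isdeep x -> ~ isdeep y -> c x = c y -> pB x = pB y ->
    path_within (w%:R + (DG + w%:R)) x y.
  move=> Bx By; rewrite !c_base // => cxy [pxy].
  have lev v : ~ isdeep v -> path_within w%:R (Base (foot v)) v.
    move=> /notdeep vw; apply: path_within_le (path_within_foot _ subH v).
    by rewrite ler_nat.
  apply: path_within_trans (path_within_sym (lev _ Bx)) (path_within_trans _ (lev _ By)).
  by apply: path_within_cayley; exact: cGB.
have DG0 : 0 <= DG.
  exact (path_within_ge0 (@bowditch_edge_length _ _ _ _ _)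
    (path_within_cayley H (cGB 1%g 1%g erefl erefl))).
exists (D + s + (w%:R + (DG + w%:R)) + (D + s)).
apply: (colorable_absorb (A := isdeep) (c := c) (pA := pA) (pB := pB)).
- move=> [g|i g k] /=; first exact: cGk.
  by case: ifP => // _; have [+ _ _] := cpP i; apply.
- by move=> x y; exact: path_within_sym.
- move=> x y [i [u [-> wu]]] [j [v [-> wv]]] uv.
  have [|y' [l [e _]]] := path_within_horoball uv.
    by apply: lt_le_trans sw' _; rewrite ler_nat; apply: leqW.
  have ij : j = i by case: e.
  subst j; rewrite !c_deep // => cuv.
  have [_ cN _] := cpP i; have puv := cN _ _ wu wv uv cuv.
  by case: u v puv {wu wv uv cuv e} => [g k] [h m] /= ->.
- move=> x y Bx By xy; apply: (sameB _ _ s) => //; rewrite /s2; lra.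
- move=> x x' y y' Ax Ax' By By' cx cy cy' pxx xy xy'.
  apply: (sameB _ _ s2) => //; last by rewrite cy cy'.
  apply: path_within_trans (path_within_sym xy) (path_within_trans _ xy').
  exact: sameA.
- move=> x y Ax Ay cxy pxy; apply: path_within_le (sameA _ _ Ax Ay cxy pxy).
  by have := ler0n R w; lra.
- move=> x y z z' Bz Bz' cy cz cz' pzz xz yz.
  have join x1 y1 : x1 = y1 \/ isdeep x1 /\ (exists x', [/\ isdeep x', c x' = c x1,
      pA x' = pA x1 & path_within s x' y1]) -> path_within (D + s) x1 y1.
    move=> [->|[Ax [x' [Ax' cx px xy]]]]; first by apply: path_within_refl; lra.
    exact: path_within_trans (path_within_sym (sameA _ _ Ax' Ax cx px)) xy.
  apply: path_within_trans (path_within_trans (join _ _ xz) (boundB _ _ Bz Bz' _ pzz)) _.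
    by rewrite cz cz'.
  exact: path_within_sym (join _ _ yz).
Qed.

Lemma asdim_bowditch_le (N : nat) :
  (forall r : R, 0 < r -> exists D : R, has_cover (word_dist R T) r D N) ->
  (forall i, exists2 m, (m < N)%N & exists L r0 : R,
     forall r, r0 < r -> has_cover (dH i) r (L * r) m) ->
  (asdim dX <= N%:R%:E)%E.
Proof.
move=> covG covH; apply: ereal_inf_lbound; exists N => // r r0.
(* The 3 is the cost in [nearest_vertex] of replacing points by vertices. *)
have [|D HD] := @bowditch_colorable N (r + 3) _ covG covH; first lra.
have [nu [nu_within nu_dist]] := nearest_vertex (@bowditch_loopless R _ _ H S)
  (@bowditch_edge_length R _ _ H S) (@bowditch_edge_uniq R _ _ H S)
  (@bowditch_connected R _ _ H S subH genS).
exists (D + 2); suff [U HU] : has_cover dX r (D + 2) N by exists U.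
apply: has_cover_of_colorable; apply: colorable_sub (colorable_pullback nu HD) => //.
- by move=> x y; exact: nu_within.
- by move=> x y; exact: nu_dist.
Qed.

End Bowditch.

(* S defines the Bowditch space; T and TH i are arbitrary finite generating sets,
   defining the word metrics of G and H i. *)
Theorem proposition3p4 (R : realType) (G : groupType) (n : nat)
    (H : 'I_n -> set G) (S T : set G) (TH : 'I_n -> set G)
    (subH : forall i, subgroup (H i))
    (finS : finite_set S) (genS : generates S setT)
    (genSH : forall i, generates (S `&` H i) (H i))
    (hypG : relatively_hyperbolic R H S)
    (finT : finite_set T) (genT : generates T setT)
    (finTH : forall i, finite_set (TH i))
    (genTH : forall i, generates (TH i) (H i)) :
  let asdimG := asdim (word_dist R T) in
  let asdimX := asdim (bowditch_dist R H S) in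
  let m := (\big[maxe/0]_(i < n)
    lasdim (fun h h' : H i => word_dist R (TH i) (val h) (val h')))%E in
  (maxe asdimG m <= asdimX)%E /\ (asdimX <= maxe asdimG (m + 1))%E.
Proof.
move=> asdimG asdimX m; split.
  rewrite ge_max; apply/andP; split.
    exact: asdim_group_le.
  (* The maximum starts from 0, so 0 <= asdim X(G) has to be checked as well. *)
  apply: bigmax_le => [|i _]; last exact: lasdim_subgroup_le.
  by apply: le_ereal_inf_tmp => _ [k _ <-]; rewrite lee_fin ler0n.
have [mE|[M mE lasM]] : m = +oo%E \/ exists2 M : nat, m = M%:R%:E &
    forall i, exists2 k, (k <= M)%N & exists L r0 : R, forall r, r0 < r ->
      has_cover (fun h h' : H i => word_dist R (TH i) (val h) (val h')) r (L * r) k.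
- have lasm i : (lasdim (fun h h' : H i => word_dist R (TH i) (val h) (val h')) <= m)%E.
    exact: le_bigmax.
  have : m = +oo%E \/ exists M : nat, m = M%:R%:E.
    rewrite /m; elim/big_ind: _ => [|x y IHx IHy|i _].
    + by right; exists 0%N.
    + by case: leP.
    + case: (lasdimP (fun h h' : H i => word_dist R (TH i) (val h) (val h'))) => [->|[k -> _]].
        by left.
      by right; exists k.
  case=> [mE|[M mE]]; [by left|right; exists M => // i].
  case: (lasdimP (fun h h' : H i => word_dist R (TH i) (val h) (val h'))) => [e|[k e cov]].
    by have := lasm i; rewrite e mE.
  by exists k => //; have := lasm i; rewrite e mE lee_fin ler_nat.
- by rewrite mE addye // le_max leey orbT.
have [e|[k e cov]] := asdimP (word_dist R T).
  by rewrite /asdimG e le_max leey.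
(* With N = max(k, M + 1), every dimension l <= M satisfies l < N; the strict inequality leaves room
   for the extra colour of the horoballs. *)
apply: (@le_trans _ _ (maxn k M.+1)%:R%:E); last first.
  rewrite /asdimG e mE -EFinD natr1 le_max !lee_fin !ler_nat.
  by case: (leqP k M.+1); rewrite ?leqnn ?orbT // => /ltnW; rewrite leqnn.
apply: (asdim_bowditch_le subH finS genS genSH finT genT finTH genTH).
- move=> r /cov[D HD]; exists D; apply: has_coverS HD.
  by rewrite leq_maxl.
- move=> i; have [l lM cov_l] := lasM i; exists l => //.
  by rewrite (leq_ltn_trans lM) // leq_maxr.
Qed.
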